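(* For any Legendrian knot $K\subset\mathbb{R}^3$ and Legendrian link $L\subset J^1(S^1)$ with $\mathbb{Z}/d$-valued Maslov potentials, we have $$R^d_{S(K,L)}(z)\ \geq\ R^d_L(z),$$ where $\geq$ refers to inequality between all coefficients of corresponding powers of $z$.
   Context: **Legendrian links.** $\mathbb{R}^3$ and $J^1(S^1)=S^1\times\mathbb{R}^2$ carry coordinates $(x,y,z)$ and the contact structure $\ker(dz-y\,dx)$. The front of a Legendrian link is its image under $(x,y,z)\mapsto(x,z)$; the same letter denotes a link and its front. Generically a front is a union of closed curves without vertical tangencies, immersed except at semicubical cusps, with only transverse double points (crossings). Fronts in $J^1(S^1)$ lie in the annulus $[0,1]\times\mathbb{R}$ with $x=0$ and $x=1$ identified. The rotation number of an oriented Legendrian knot is $r=\frac12(\#\text{downward cusps}-\#\text{upward cusps})$; for a link $r$ is the gcd of the rotation numbers of the components. **Maslov potentials.** For $d$ dividing $2r$, a $d$-graded Maslov potential is a $\mathbb{Z}/d$-valued function on the front, constant except at cusps, where it increases by $1$ from the lower to the upper branch; if $d$ is even it is required to be even on strands oriented in the positive $x$-direction. Here $d$ is a common divisor of $2r(K)$ and $2r(L)$. **Satellite.** $K$ is oriented and connected with base point $*$; $L$ has generic front with singularities away from $x=0$. Let $n$ be the number of points of $L$ on $x=0$. Take $n$ copies of the front of $K$, each successive one shifted slightly downward in $z$. Cut the front of $L$ open along $x=0$, scale it, and insert it into the $n$ parallel strands at the location of $*$, directly if $K$ is oriented to the right at $*$, and reflected across a vertical axis if it is oriented to the left. The result is the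 front of $S(K,L)\subset\mathbb{R}^3$, whose Legendrian isotopy type depends only on those of $K$ and $L$. If $\mu,\eta$ are the Maslov potentials on $K,L$, then $S(K,L)$ is given the Maslov potential whose value on the $i$-th strand (from the top) over a point $k\in K$ is $\mu(k)+\eta_i$ ($\eta_i$ the value of $\eta$ on the $i$-th strand at $x=0$), and which equals $\mu( * )+\eta$ on the inserted copy of $L$. Fronts are perturbed by planar isotopy so that all crossings and cusps have distinct $x$-coordinates. **Normal rulings.** Let $L$ be a front in $M\times\mathbb{R}$, $M=\mathbb{R}$ or $S^1$, with all crossings and cusps at distinct $x$-coordinates, let $\pi(x,z)=x$, and let $\Sigma\subset M$ be the set of $x$-coordinates of crossings and cusps. A normal ruling is a continuous fixed-point-free involution $\rho$ of $L\setminus\pi^{-1}(\Sigma)$ with $\pi\circ\rho=\pi$ such that: (a) near a cusp, $\rho$ interchanges the two branches of the cusp, and on the remaining strands it is the same on both sides; (b) strands meeting at a crossing are not paired by $\rho$; (c) near a crossing at $x_0$, over a small interval $N\ni x_0$, $L$ is covered by continuous sections $f_i:N\to L$ ($\pi\circ f_i=\mathrm{id}$), each point other than the crossing lying on exactly one section and the crossing on exactly two, such that away from $x_0$ each $\rho\circ f_i$ equals some $f_j$. The two sections through the crossing either cross transversely following the diagram, or each turns a corner there, one covering the upper half and the other the lower half of the crossing; in the latter case the crossing is a switch; (d) (normality) near a switch, the two vertical intervals joining each switching strand to the strand paired with it are either disjoint or nested. It is $d$-graded with respect to $\mu$ if $\mu(x,z')=\mu(x,z)+1$ mod $d$ whenever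 $\rho(x,z)=(x,z')$ with $z<z'$. **Ruling polynomial.** $R^d(z)=\sum_\rho z^{j(\rho)}$, summed over all $d$-graded normal rulings of the front, with $j(\rho)=\#\text{switches}-\#\text{right cusps}$. It is a $d$-graded Legendrian isotopy invariant. *)

(* Defs.v *)
From HB Require Import structures.
From mathcomp Require Import all_boot all_order all_algebra.
From mathcomp Require Import freeg.

Set Implicit Arguments.
Unset Strict Implicit.
Unset Printing Implicit Defensive.

Import Order.TTheory GRing.Theory Num.Theory.

(* A generic front whose crossings and cusps have distinct x-coordinates is
   recorded, up to planar isotopy, by the list of these singularities read from
   left to right.  Strands over a fixed x are numbered 0, 1, ... from the TOP.
   - Crossing k : strands k and k+1 cross;
   - LCusp k    : a left cusp creates two adjacent strands, numbered k and k+1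
                  immediately to its right;
   - RCusp k    : strands k and k+1 end at a right cusp. *)
Inductive event := Crossing of nat | LCusp of nat | RCusp of nat.

(* Fronts in J^1(S^1) are cut open along x = 0, where no singularity lies:
   [base] is the number of points over x = 0, and the i-th strand at x = 1 is
   glued to the i-th strand at x = 0.  Fronts in R^3 are those with base = 0. *)
Record front := Front { base : nat; word : seq event }.

Definition fits (m : nat) (e : event) : bool :=
  match e with
  | Crossing k => k.+1 < m
  | LCusp k => k <= m
  | RCusp k => k.+1 < m
  end.

Definition after (m : nat) (e : event) : nat :=
  match e with
  | Crossing _ => m
  | LCusp _ => m.+2
  | RCusp _ => m - 2
  end.

Definition ev (F : front) (j : nat) : event := nth (Crossing 0) (word F) j.

(* The singularities cut the x-axis into size (word F) + 1 regions; region j lies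
   just before the j-th singularity (counting from 0).  For M = S^1 the first and
   the last region are two parts of the same component of M \ Sigma. *)
Definition width (F : front) (j : nat) : nat :=
  foldl after (base F) (take j (word F)).

Definition is_front (F : front) : Prop :=
  (forall j, j < size (word F) -> fits (width F j) (ev F j)) /\
  width F (size (word F)) = base F.

(* A strand over region j that avoids the cusp continues across the j-th
   singularity: [joins e i i'] says that strand i on its left is strand i' on its
   right (for the smooth arcs of the front, so strands do cross at a crossing). *)
Definition swap (k i : nat) : nat :=
  if i == k then k.+1 else if i == k.+1 then k else i.

Definition skip2 (k i : nat) : nat := if i < k then i else i.+2.

Definition joins (e : event) (i i' : nat) : bool :=
  match e with
  | Crossing k => i' == swap k i
  | LCusp k => i' == skip2 k i
  | RCusp k => i == skip2 k i'
  end.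

(* The cusps of F, as triples (region, strand, side): over [region], the upper
   branch is [strand] and the lower branch is [strand.+1]; [side] is true for
   right cusps. *)
Definition cusp_at (F : front) (j : nat) : option (nat * nat * bool) :=
  match ev F j with
  | Crossing _ => None
  | LCusp k => Some (j.+1, k, false)
  | RCusp k => Some (j, k, true)
  end.

Definition cusps (F : front) : seq (nat * nat * bool) :=
  pmap (cusp_at F) (iota 0 (size (word F))).

(* Locally constant data on a front is given by functions of (region, strand);
   their values off the front are irrelevant. *)
Definition constant_on_strands (T : Type) (E : T -> T -> Prop) (F : front)
    (f : nat -> nat -> T) : Prop :=
  (forall j i i', j < size (word F) -> i < width F j -> i' < width F j.+1 ->
     joins (ev F j) i i' -> E (f j i) (f j.+1 i')) /\
  (forall i, i < base F -> E (f (size (word F)) i) (f 0 i)).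

(* [o j i] is true when strand i over region j is oriented in the positive
   x-direction. *)
Definition is_orientation (F : front) (o : nat -> nat -> bool) : Prop :=
  constant_on_strands eq F o /\
  (forall j k b, (j, k, b) \in cusps F -> o j k = ~~ o j k.+1).

Definition segment (F : front) : finType :=
  {j : 'I_(size (word F)).+1 & 'I_(width F j)}.

Definition adjacent (F : front) : rel (segment F) := fun s t =>
  let j : nat := tag s in let i : nat := tagged s in
  let j' : nat := tag t in let i' : nat := tagged t in
  [|| (j' == j.+1) && joins (ev F j) i i',
      [&& j' == j, i' == i.+1 & has (fun c => c.1 == (j, i)) (cusps F)]
    | [&& j == size (word F), j' == 0 & i' == i]].

Definition same_component (F : front) : rel (segment F) :=
  connect (fun s t => adjacent s t || adjacent t s).

Definition is_connected (F : front) : Prop :=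
  (exists s : segment F, true) /\ (forall s t : segment F, same_component s t).

Definition on_component (F : front) (s : segment F) (j k : nat) : bool :=
  [exists t : segment F, [&& same_component s t, tag t == j :> nat
                                              & tagged t == k :> nat]].

Definition component_cusps (F : front) (s : segment F) :=
  [seq c <- cusps F | on_component s c.1.1 c.1.2].

(* A cusp is traversed downwards iff its upper branch is oriented towards it. *)
Definition downward (o : nat -> nat -> bool) (c : nat * nat * bool) : bool :=
  o c.1.1 c.1.2 == c.2.

Section IntScope.

Local Open Scope ring_scope.

(* The division by 2 is exact. *)
Definition component_rotation (F : front) (o : nat -> nat -> bool)
    (s : segment F) : int :=
  (((count (downward o) (component_cusps s))%:Z
    - (count (predC (downward o)) (component_cusps s))%:Z) %/ 2)%Z.

Definition rotation (F : front) (o : nat -> nat -> bool) : nat :=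
  (\big[gcdn/0%N]_(s : segment F) `|component_rotation o s|)%N.

(* Z/d-valued potentials are represented by integer-valued ones, all equalities
   being read modulo d; d = 0 gives Z-valued potentials. *)
Definition maslov_potential (d : nat) (F : front) (o : nat -> nat -> bool)
    (mu : nat -> nat -> int) : Prop :=
  [/\ constant_on_strands (fun a b => (a = b %[mod d])%Z) F mu,
      forall j k b, (j, k, b) \in cusps F ->
        (mu j k = mu j k.+1 + 1 %[mod d])%Z
    & ~~ odd d -> forall j i, (j <= size (word F))%N -> (i < width F j)%N ->
        o j i -> (2 %| mu j i)%Z].

End IntScope.

(* A fixed-point-free involution over M \ Sigma commuting with the projection
   amounts, by continuity, to one involution of the strands over each region;
   for M = S^1 the first and last regions must carry the same one. *)
Definition pairing (F : front) : finType :=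
  {dffun forall j : 'I_(size (word F)).+1,
           {ffun 'I_(width F j) -> 'I_(width F j)}}.

Definition partner (F : front) (rho : pairing F) (j i : nat) : nat :=
  if insub i is Some i' then rho (inord j) i' else i.

(* Below, f and g are the involutions to the left and to
   the right of a singularity e, between m and m' strands. *)

Definition follows (e : event) (m m' : nat) (f g : nat -> nat) : bool :=
  [forall i : 'I_m, [forall i' : 'I_m', joins e i i' ==> joins e (f i) (g i')]].

(* When the two sections through a crossing turn a corner there, all sections
   keep their height, so that f and g agree. *)
Definition turns (m : nat) (f g : nat -> nat) : bool :=
  [forall i : 'I_m, f i == g i].

Definition normal (k : nat) (f : nat -> nat) : bool :=
  let a := minn k (f k) in let b := maxn k (f k) in
  let a' := minn k.+1 (f k.+1) in let b' := maxn k.+1 (f k.+1) in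
  [|| b < a', b' < a, (a <= a') && (b' <= b) | (a' <= a) && (b <= b')].

Definition ruled_event (e : event) (m m' : nat) (f g : nat -> nat) : bool :=
  match e with
  | LCusp k => (g k == k.+1) && follows e m m' f g
  | RCusp k => (f k == k.+1) && follows e m m' f g
  | Crossing k => [&& f k != k.+1, g k != k.+1
                    & follows e m m' f g || turns m f g && normal k f]
  end.

Definition normal_ruling (F : front) (rho : pairing F) : bool :=
  [&& [forall j : 'I_(size (word F)).+1, [forall i : 'I_(width F j),
         (rho j i != i) && (rho j (rho j i) == i)]],
      [forall i : 'I_(base F), partner rho (size (word F)) i == partner rho 0 i]
    & [forall j : 'I_(size (word F)),
         ruled_event (ev F j) (width F j) (width F j.+1)
                     (partner rho j) (partner rho j.+1)]].

(* i < partner rho j i means that strand i is above its partner. *)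
Definition graded (d : nat) (F : front) (mu : nat -> nat -> int)
    (rho : pairing F) : bool :=
  [forall j : 'I_(size (word F)).+1, [forall i : 'I_(width F j),
     (i < partner rho j i) ==>
     (mu j i == (mu j (partner rho j i) + 1)%R %[mod d])%Z]].

Definition is_switch (F : front) (rho : pairing F) (j : nat) : bool :=
  if ev F j is Crossing k
  then turns (width F j) (partner rho j) (partner rho j.+1) else false.

Definition switches (F : front) (rho : pairing F) : nat :=
  #|[set j : 'I_(size (word F)) | is_switch rho j]|.

Definition right_cusps (F : front) : nat := count (fun c => c.2) (cusps F).

Definition ruling_degree (F : front) (rho : pairing F) : int :=
  ((switches rho)%:Z - (right_cusps F)%:Z)%R.

(* Laurent polynomials in z with integer coefficients, as an additive group: the
   free abelian group on the exponents, << m >> being the monomial z^m. *)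
Definition ruling_polynomial (d : nat) (F : front) (mu : nat -> nat -> int) :
    {freeg int / int} :=
  (\sum_(rho : pairing F | normal_ruling rho && graded d mu rho)
     << ruling_degree rho >>)%R.

(* Reflection across a vertical axis. *)
Definition mirror_event (e : event) : event :=
  match e with
  | Crossing k => Crossing k
  | LCusp k => RCusp k
  | RCusp k => LCusp k
  end.

Definition mirror (w : seq event) : seq event := rev (map mirror_event w).

Definition shift_event (a : nat) (e : event) : event :=
  match e with
  | Crossing k => Crossing (a + k)
  | LCusp k => LCusp (a + k)
  | RCusp k => RCusp (a + k)
  end.

(* Singularities of n downward-shifted copies near one singularity of K; the
   copies of strand a of K are the strands n * a, ..., n * a + n - 1.
   At a crossing, copy t of the rising strand passes the copies n-1, ..., 0 of the
   descending one, successively for t = 0, ..., n-1.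
   At a left cusp the n cusps come first, and give the strands
   U_0, L_0, U_1, L_1, ... (upper and lower branches); then, for
   t = 1, ..., n-1, U_t passes L_(t-1), ..., L_0.  Right cusps are symmetric. *)
Definition copy_lcusp (n k : nat) : seq event :=
  [seq LCusp (n * k + 2 * t) | t <- iota 0 n] ++
  [seq Crossing (n * k + (2 * t - u).-1) | t <- iota 0 n, u <- iota 0 t].

Definition copy (n : nat) (e : event) : seq event :=
  match e with
  | Crossing k =>
      [seq Crossing (n * k + (n + t - u).-1) | t <- iota 0 n, u <- iota 0 n]
  | LCusp k => copy_lcusp n k
  | RCusp k => mirror (copy_lcusp n k)
  end.

Definition insertion (L : front) (to_right : bool) : seq event :=
  if to_right then word L else mirror (word L).

(* The base point * of K is on strand s over region p; oK is the orientation
   of K. *)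
Definition satellite (K L : front) (oK : nat -> nat -> bool) (p s : nat) :
    front :=
  let n := base L in
  Front 0 (flatten (map (copy n) (take p (word K)))
           ++ map (shift_event (n * s)) (insertion L (oK p s))
           ++ flatten (map (copy n) (drop p (word K)))).

(* Values of a locally constant function to the right of a crossing or right cusp,
   in terms of those to its left, both listed from the top; no left cusp occurs
   where this is used. *)
Definition carry (T : Type) (l : seq T) (e : event) : seq T :=
  match e with
  | Crossing k => take k l ++ rev (take 2 (drop k l)) ++ drop k.+2 l
  | RCusp k => take k l ++ drop k.+2 l
  | LCusp _ => l
  end.

Section SatellitePotential.

Variables (K L : front) (oK : nat -> nat -> bool) (p s : nat).
Variables (mu eta : nat -> nat -> int).

Local Open Scope ring_scope.

(* Potentials of all strands of the satellite over region j of K, from the top. *)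
Definition copies_row (j : nat) : seq int :=
  [seq mu j a + eta 0 i | a <- iota 0 (width K j), i <- iota 0 (base L)].

(* The same over the regions strictly between the singularities of the n-copy of
   the j-th singularity of K, preceded by region j itself.  At a left cusp they
   are obtained from right to left, the reflected picture being a right cusp. *)
Definition copy_rows (j : nat) : seq (seq int) :=
  if ev K j is LCusp k then
    rev (scanl (@carry int) (copies_row j.+1) (copy (base L) (RCusp k)))
  else
    belast (copies_row j)
           (scanl (@carry int) (copies_row j) (copy (base L) (ev K j))).

(* The same over the regions of the inserted front, the last one excepted. *)
Definition insertion_rows : seq (seq int) :=
  [seq take (base L * s) (copies_row p)
       ++ [seq mu p s + eta q b | b <- iota 0 (width L q)]
       ++ drop (base L * s.+1) (copies_row p)
  | q <- if oK p s then iota 0 (size (word L))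
         else rev (iota 1 (size (word L)))].

Definition satellite_rows : seq (seq int) :=
  flatten (map copy_rows (iota 0 p)) ++ insertion_rows
  ++ flatten (map copy_rows (iota p (size (word K) - p)))
  ++ [:: copies_row (size (word K))].

Definition satellite_potential (j i : nat) : int :=
  nth 0 (nth [::] satellite_rows j) i.

End SatellitePotential.

(* Main.v *)
Require Import Defs.
From HB Require Import structures.
From mathcomp Require Import all_boot all_order all_algebra.
From mathcomp Require Import freeg zify.

Set Implicit Arguments.
Unset Strict Implicit.
Unset Printing Implicit Defensive.

Import Order.TTheory GRing.Theory Num.Theory.

(** The inequality holds because every [d]-graded normal ruling [rho] of [L]
extends, without loss of information, to a [d]-graded normal ruling of the
satellite with the same exponent.

Let [n] be the number of strands of [L] over x = 0 and let [rho] pair strand [i]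
with strand [i'] there.  Away from the singularities of [K], the [i]-th copy of
each strand of [K] is paired with its [i']-th copy, and [rho] itself is used on
the inserted front; the two fit together since [rho] is the same over x = 0 and
over x = 1.  At a crossing of [K] two different strands cross, so paired copies
never meet and all [n * n] crossings are passed without a switch
([sweep_crossing]).

At a right cusp of [K], with copies U_0, U_1, ... of its upper and L_0, L_1, ...
of its lower branch, the pairs are {U_i, U_i'} and {L_i, L_i'} to the left, but
each of the [n] new cusps has to see a pair {U_i, L_i}.  For every [i > i'], a
switch at the crossing of U_i with L_i' turns {U_i, U_i'} and {L_i, L_i'} into
{U_i, L_i} and {U_i', L_i'}.  Just right of this switch the vertical intervals
of the two pairs are disjoint, so the switch is normal ([moves_switch]), and
these [n / 2] switches suffice ([sweep_rcusp]).  Left cusps are the mirror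
images of right cusps.

A knot in R^3 has as many left as right cusps, so a front [K] with [c] right
cusps contributes [2 c * (n / 2) = n c] switches, which is exactly the number of
right cusps in its [n]-copy: the exponent of [z] does not change
([satellite_ruling]).  As [rho] is the restriction of the new ruling to the
inserted front, distinct rulings of [L] give distinct rulings of the satellite,
and the coefficients count rulings of a given exponent.

A ruling is handled as the list, region by region, of the partners of the
strands.  The strands over a region are juxtaposed blocks, and a singularity
that touches one block leaves the others alone ([step_dsum_l], [step_dsum_r]);
this reduces the [n]-copy of a singularity of [K] to the case where [K] has just
the two strands that meet there. *)

(** The innermost conditionals are split first, so that each condition is a plain
    comparison. *)
Ltac case_lia :=
  repeat match goal with |- context [if ?c then _ else _] =>
    lazymatch c with
    | context [if _ then _ else _] => fail
    | _ => case: (boolP c) => ?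
    end
  end; lia.

(** * Rows of strands and their pairings *)

(** The pairing of the strands over one region is the list [f] of partners.
    Positions beyond the list are their own partners, in agreement with
    [partner]. *)
Definition mate (f : seq nat) (i : nat) : nat := nth i f i.

Definition matching (f : seq nat) : Prop :=
  forall i, i < size f -> [/\ mate f i < size f, mate f i != i & mate f (mate f i) = i].

Definition graded_row (d : nat) (r : seq int) (f : seq nat) : Prop :=
  size r = size f /\
  forall i, i < size f -> i < mate f i ->
    (nth 0 r i == nth 0 r (mate f i) + 1 %[mod d])%Z.

Definition step (e : event) (f g : seq nat) : Prop :=
  [/\ fits (size f) e, size g = after (size f) e, matching f, matching g
    & ruled_event e (size f) (size g) (mate f) (mate g)].

Definition switch_at (e : event) (f g : seq nat) : bool :=
  if e is Crossing k then turns (size f) (mate f) (mate g) else false.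

Lemma mate_out f i : size f <= i -> mate f i = i.
Proof. by move=> ?; rewrite /mate nth_default. Qed.

Lemma followsP e m m' f g :
  reflect (forall i i', i < m -> i' < m' -> joins e i i' -> joins e (f i) (g i'))
          (follows e m m' f g).
Proof.
apply: (iffP forallP) => [H i i' im i'm Hj|H i].
  by have /forallP/(_ (Ordinal i'm))/implyP := H (Ordinal im); apply.
by apply/forallP => i'; apply/implyP; apply: H.
Qed.

Lemma turnsP m f g : reflect (forall i, i < m -> f i = g i) (turns m f g).
Proof.
apply: (iffP forallP) => [H i im|H i]; first by apply/eqP: (H (Ordinal im)).
by apply/eqP/H.
Qed.

(** * Reflection in a vertical axis *)

Lemma joins_mirror e i i' : joins (mirror_event e) i' i = joins e i i'.
Proof. by case: e => k //=; rewrite /swap; case_lia. Qed.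

Lemma follows_mirror e m m' f g :
  follows (mirror_event e) m' m g f = follows e m m' f g.
Proof.
apply/followsP/followsP => H i i' im i'm' Hj.
  by rewrite -joins_mirror; apply: H => //; rewrite joins_mirror.
by rewrite joins_mirror; apply: H => //; rewrite -joins_mirror.
Qed.

Lemma turnsC m f g : turns m f g = turns m g f.
Proof. by apply: eq_forallb => i; rewrite eq_sym. Qed.

(** Every condition on a ruling at a singularity is symmetric in its two
    sides.  For normality this is so because the two pairings agree at a
    switch. *)
Lemma step_mirror e f g : step e f g -> step (mirror_event e) g f.
Proof.
case=> ft sz mf mg; move: ft sz; case: e => k /= ft sz H; split=> //=.
- by rewrite sz.
- case/and3P: H => fk gk /orP[H|/andP[tu no]].
    rewrite fk gk -(follows_mirror (Crossing k)) /= in H *.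
    by rewrite H.
  rewrite fk gk sz turnsC tu /=; apply/orP; right.
  by rewrite /normal -!(turnsP _ _ _ tu) // ltnW.
- by lia.
- by lia.
- by case/andP: H => -> H; rewrite -(follows_mirror (LCusp k)) in H.
- by lia.
- by lia.
- by case/andP: H => -> H; rewrite -(follows_mirror (RCusp k)) in H.
Qed.

Lemma switch_mirror e f g : step e f g ->
  switch_at (mirror_event e) g f = switch_at e f g.
Proof. by case: e => k //= [_ /= -> _ _ _]; rewrite turnsC. Qed.

(** * Juxtaposition of rows *)

(** The pairing of two rows placed one below the other, with no pair across. *)
Definition dsum (f g : seq nat) : seq nat := f ++ map (addn (size f)) g.

Lemma size_dsum f g : size (dsum f g) = size f + size g.
Proof. by rewrite size_cat size_map. Qed.

Lemma mate_dsum f g i :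
  mate (dsum f g) i = if i < size f then mate f i else size f + mate g (i - size f).
Proof.
rewrite /mate nth_cat; case: ltnP => H.
  exact: set_nth_default.
case: (ltnP (i - size f) (size g)) => Hg.
  by rewrite (nth_map (i - size f)).
rewrite !nth_default ?size_map //; lia.
Qed.

Lemma dsumA f g h : dsum f (dsum g h) = dsum (dsum f g) h.
Proof.
rewrite /dsum map_cat catA -map_comp; congr (_ ++ _).
by apply: eq_map => x /=; rewrite size_cat size_map addnA.
Qed.

Lemma dsumf0 f : dsum f [::] = f.
Proof. by rewrite /dsum cats0. Qed.

Lemma dsum0f f : dsum [::] f = f.
Proof. by rewrite /dsum /= map_id. Qed.

Lemma matching_dsum f g : matching f -> matching g -> matching (dsum f g).
Proof.
move=> mf mg i; rewrite size_dsum => Hi; rewrite !mate_dsum.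
case: (ltnP i (size f)) => H.
  by have [a b c] := mf i H; rewrite a; split=> //; lia.
have [|a b c] := mg (i - size f); first lia.
rewrite ifN; last lia.
by rewrite addKn c; split; lia.
Qed.

Lemma graded_dsum d r s f g :
  graded_row d r f -> graded_row d s g -> matching f -> matching g ->
  graded_row d (r ++ s) (dsum f g).
Proof.
move=> [sr Hr] [ss Hs] mf mg; split=> [|i]; first by rewrite size_cat size_dsum sr ss.
rewrite size_dsum mate_dsum => Hi; rewrite !nth_cat sr; case: (ltnP i (size f)) => H.
  by have [-> _ _] := mf i H => Hlt; apply: Hr.
move=> Hlt; rewrite ifN; last lia.
by rewrite addKn; apply: Hs; lia.
Qed.

Lemma fits_shift a m e : fits (a + m) (shift_event a e) = fits m e.
Proof. by case: e => k /=; lia. Qed.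

Lemma after_shift a m e : fits m e ->
  after (a + m) (shift_event a e) = a + after m e.
Proof. by case: e => k /=; lia. Qed.

Lemma fits_wide m n e : fits m e -> fits (m + n) e.
Proof. by case: e => k /=; lia. Qed.

Lemma after_wide m n e : fits m e -> after (m + n) e = after m e + n.
Proof. by case: e => k /=; lia. Qed.

Lemma switch_dsum_l A e f g :
  switch_at (shift_event (size A) e) (dsum A f) (dsum A g) = switch_at e f g.
Proof.
case: e => k //=; rewrite size_dsum; apply/turnsP/turnsP => H i Hi.
  have := H (size A + i); rewrite !mate_dsum !ifN -?leqNgt ?leq_addr //.
  by rewrite addKn ltn_add2l => /(_ Hi) /addnI.
rewrite !mate_dsum; case: ltnP => // HA; rewrite H //; lia.
Qed.

Lemma switch_dsum_r B e f g : step e f g ->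
  switch_at e (dsum f B) (dsum g B) = switch_at e f g.
Proof.
case=> _ sz _ _ _; move: sz; case: e => k //= sz.
rewrite size_dsum; apply/turnsP/turnsP => H i Hi.
  by have := H i; rewrite !mate_dsum sz Hi; apply; lia.
by rewrite !mate_dsum sz; case: ltnP => // HA; rewrite H.
Qed.

Lemma joins_shift a e i i' :
  joins (shift_event a e) i i' =
  if (i < a) || (i' < a) then i == i' else joins e (i - a) (i' - a).
Proof. by case: e => k /=; rewrite /swap /skip2; case_lia. Qed.

Lemma joins_wide m e i i' : fits m e -> (m <= i) || (after m e <= i') ->
  joins e i i' = (i + after m e == i' + m).
Proof. by case: e => k /=; rewrite /swap /skip2; case_lia. Qed.

Lemma follows_dsum_l A e f g : matching A ->
  follows e (size f) (size g) (mate f) (mate g) ->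
  follows (shift_event (size A) e) (size (dsum A f)) (size (dsum A g))
          (mate (dsum A f)) (mate (dsum A g)).
Proof.
move=> mA /followsP H; apply/followsP=> i i'; rewrite !size_dsum => Hi Hi'.
rewrite joins_shift !mate_dsum.
case: (ltnP i (size A)) => /= HiA.
  move=> /eqP <-; rewrite HiA joins_shift; have [-> _ _] := mA i HiA.
  by rewrite eqxx.
case: (ltnP i' (size A)) => /= Hi'A; first by move=> /eqP; lia.
move=> Hj; rewrite joins_shift ifN; last lia.
by rewrite !addKn; apply: H => //; lia.
Qed.

Lemma follows_dsum_r B e f g :
  fits (size f) e -> size g = after (size f) e -> matching f -> matching g ->
  follows e (size f) (size g) (mate f) (mate g) ->
  follows e (size (dsum f B)) (size (dsum g B)) (mate (dsum f B)) (mate (dsum g B)).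
Proof.
move=> ft sz mf mg /followsP H; apply/followsP=> i i'; rewrite !size_dsum => Hi Hi'.
rewrite !mate_dsum.
case: (ltnP i (size f)) => HiA; case: (ltnP i' (size g)) => Hi'A.
- exact: H.
- by rewrite (@joins_wide (size f)) // -?sz; lia.
- by rewrite (@joins_wide (size f)) // -?sz; lia.
rewrite !(@joins_wide (size f)) // -?sz; try lia.
move=> Hj; have -> : i - size f = i' - size g by lia.
lia.
Qed.

Lemma normal_dsum_l A k f : normal k (mate f) ->
  normal (size A + k) (mate (dsum A f)).
Proof.
rewrite /normal -addnS !mate_dsum !ifN -?leqNgt ?leq_addr //.
rewrite !addKn; lia.
Qed.

(** A singularity of the lower block is also one of the whole row: the
    strands of the upper block go straight through. *)
Lemma step_dsum_l A e f g : matching A -> step e f g ->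
  step (shift_event (size A) e) (dsum A f) (dsum A g).
Proof.
move=> mA [ft sz mf mg H]; split.
- by rewrite size_dsum fits_shift.
- by rewrite !size_dsum after_shift // sz.
- exact: matching_dsum.
- exact: matching_dsum.
have sw := switch_dsum_l A e f g.
have fo := @follows_dsum_l A e f g mA.
case: e ft sz H sw fo => k ft sz /= H sw fo.
- rewrite sw; case/and3P: H => fk gk H.
  rewrite -addnS !mate_dsum !ifN -?leqNgt ?leq_addr // !addKn !eqn_add2l fk gk /=.
  case/orP: H => [/fo -> //|/andP[-> /normal_dsum_l ->]]; exact: orbT.
- rewrite -addnS !mate_dsum !ifN -?leqNgt ?leq_addr // !addKn !eqn_add2l.
  by case/andP: H => -> /fo.
- rewrite -addnS !mate_dsum !ifN -?leqNgt ?leq_addr // !addKn !eqn_add2l.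
  by case/andP: H => -> /fo.
Qed.

Lemma step_dsum_r B e f g : matching B -> step e f g ->
  step e (dsum f B) (dsum g B).
Proof.
move=> mB st; have [ft sz mf mg H] := st; split.
- by rewrite size_dsum fits_wide.
- by rewrite !size_dsum after_wide // sz.
- exact: matching_dsum.
- exact: matching_dsum.
have sw := switch_dsum_r B st.
have fo := @follows_dsum_r B e f g ft sz mf mg.
case: e {st} ft sz H sw fo => k ft sz /= H sw fo.
- rewrite sw; case/and3P: H => fk gk H; simpl in ft, sz.
  have k1 : k < size f by lia.
  rewrite !mate_dsum sz k1 fk gk /=.
  case/orP: H => [/fo -> //|/andP[-> no]].
  by apply/orP; right; rewrite /normal !mate_dsum k1 ft.
- simpl in ft, sz.
  have k1 : k < size g by lia.
  by rewrite !mate_dsum k1; case/andP: H => -> /fo.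
- simpl in ft, sz.
  have k1 : k < size f by lia.
  by rewrite !mate_dsum k1; case/andP: H => -> /fo.
Qed.

(** * Ruled pieces of fronts *)

(** [run d rs fs w g c]: the singularities [w] are crossed from left to
    right, [rs] and [fs] list the potentials and pairings just before each of
    them, [g] is the pairing after the last one and [c] counts the switches.
    The right end is kept apart from [fs] so that two pieces can be glued even
    when their potentials at the junction agree only modulo [d]. *)
Inductive run (d : nat) :
    seq (seq int) -> seq (seq nat) -> seq event -> seq nat -> nat -> Prop :=
| run_nil g : run d [::] [::] [::] g 0
| run_cons r rs f fs e w g c :
    graded_row d r f -> step e f (head g fs) -> run d rs fs w g c ->
    run d (r :: rs) (f :: fs) (e :: w) g (switch_at e f (head g fs) + c).

Lemma run_cat d rs1 rs2 fs1 fs2 w1 w2 g c1 c2 :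
  run d rs1 fs1 w1 (head g fs2) c1 -> run d rs2 fs2 w2 g c2 ->
  run d (rs1 ++ rs2) (fs1 ++ fs2) (w1 ++ w2) g (c1 + c2).
Proof.
move=> H H2; move: {-1}(head g fs2) (erefl (head g fs2)) H => h hE H.
elim: H hE => [h' _|r rs f fs e w h' c gr st _ IH hE] //=.
have E : head h' fs = head g (fs ++ fs2) by case: (fs).
by rewrite -addnA E; apply: run_cons; rewrite -?E //; apply: IH.
Qed.

Lemma run_size d rs fs w g c : run d rs fs w g c ->
  size rs = size w /\ size fs = size w.
Proof. by elim=> //= ? ? ? ? ? ? ? ? _ _ _ [-> ->]. Qed.

Lemma run_nth d rs fs w g c j : run d rs fs w g c -> j < size w ->
  graded_row d (nth [::] rs j) (nth g fs j) /\
  step (nth (Crossing 0) w j) (nth g fs j) (nth g fs j.+1).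
Proof.
move=> H; elim: H j => [//|r rs' f fs' e w' g' c' gr st _ IH] [|j] /=.
  by rewrite nth0.
exact: IH.
Qed.

Lemma run_switches d rs fs w g c : run d rs fs w g c ->
  c = \sum_(0 <= j < size w)
        switch_at (nth (Crossing 0) w j) (nth g fs j) (nth g fs j.+1).
Proof.
elim=> [?|r rs' f fs' e w' g' c' gr st _ IH] /=; first by rewrite big_nil.
by rewrite big_nat_recl //= nth0 -IH.
Qed.

Lemma run_nil_inv d rs fs g c : run d rs fs [::] g c ->
  [/\ rs = [::], fs = [::] & c = 0].
Proof. by move=> H; inversion H. Qed.

Lemma run_cons_inv d rs fs e w g c : run d rs fs (e :: w) g c ->
  exists r rs' f fs' c',
    [/\ rs = r :: rs', fs = f :: fs', c = switch_at e f (head g fs') + c'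
      & [/\ graded_row d r f, step e f (head g fs') & run d rs' fs' w g c']].
Proof.
move=> H; inversion H as [|r rs' f fs' e' w' g' c' gr st R]; subst.
by exists r, rs', f, fs', c'.
Qed.

(** The rows before the singularities of the mirror image are those after
    the singularities of the original piece, in reverse order. *)
Lemma run_mirror d r0 rs fs w g c :
  run d (belast r0 rs) fs w g c -> graded_row d (last r0 rs) g ->
  run d (rev rs) (rev (behead (rcons fs g))) (mirror w) (head g fs) c.
Proof.
elim: w r0 rs fs c => [|e w IH] r0 rs fs c H gl.
  have [+ -> ->] := run_nil_inv H.
  by case: rs {H gl} => // _; apply: run_nil.
have [r [rs' [f [fs' [c' [Er -> -> [gr st R]]]]]]] := run_cons_inv H.
case: rs Er gl {H} => [//|r1 rs] /= [_ Er] gl.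
rewrite -{rs'}Er in R.
have R' := IH _ _ _ _ R gl.
have gr1 : graded_row d r1 (head g fs').
  case: w {IH R'} R => [|e' w] R.
    have [Er -> _] := run_nil_inv R.
    by case: rs Er gl {R}.
  have [r' [rs' [f' [fs'' [c'' [Er -> _ [gr' _ _]]]]]]] := run_cons_inv R.
  by case: rs Er {R gl} => [//|r2 rs] /= [-> _].
have R1 : run d [:: r1] [:: head g fs'] [:: mirror_event e] f (switch_at e f (head g fs')).
  rewrite -(switch_mirror st) -(addn0 (switch_at _ _ _)).
  by apply: run_cons => //; [exact: step_mirror | exact: run_nil].
rewrite addnC /mirror /= !rev_cons.
have -> : rev (rcons fs' g) = rcons (rev (behead (rcons fs' g))) (head g fs').
  by case: (fs') => //= a l; rewrite rev_cons.
rewrite -!(cats1 (rev _)); exact: (run_cat (fs2 := [:: head g fs']) R' R1).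
Qed.

(** * Pieces whose potentials are carried along *)

(** A ruled piece whose potentials follow the strands from the left end by
    [carry].  This is how the potential of the satellite is given near a
    crossing or a right cusp of the companion; near a left cusp it is given by
    the mirror image of such a piece. *)
Inductive sweep (d : nat) :
    seq int -> seq nat -> seq event -> seq int -> seq nat -> nat -> Prop :=
| sweep_nil r f : graded_row d r f -> sweep d r f [::] r f 0
| sweep_cons r f e g w r' h c :
    graded_row d r f -> step e f g -> sweep d (carry r e) g w r' h c ->
    sweep d r f (e :: w) r' h (switch_at e f g + c).

Lemma sweep_cat d r1 f1 w1 r2 f2 c1 w2 r3 f3 c2 :
  sweep d r1 f1 w1 r2 f2 c1 -> sweep d r2 f2 w2 r3 f3 c2 ->
  sweep d r1 f1 (w1 ++ w2) r3 f3 (c1 + c2).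
Proof.
move=> H H2; elim: H H2 => [//|r f e g w r' h c gr st _ IH H2] /=.
by rewrite -addnA; apply: sweep_cons => //; apply: IH.
Qed.

Lemma sweep_graded_last d r f w r' g c :
  sweep d r f w r' g c -> graded_row d r' g.
Proof. by elim. Qed.

Lemma sweep_run d r f w r' g c : sweep d r f w r' g c ->
  last r (scanl (@carry int) r w) = r' /\
  exists2 fs, head g fs = f
    & run d (belast r (scanl (@carry int) r w)) fs w g c.
Proof.
elim=> [{}r {}f gr|{}r {}f e g' {}w {}r' h {}c gr st _ [<- [fs hd R]]] /=.
  by split=> //; exists [::] => //; apply: run_nil.
split=> //; exists (f :: fs) => //; rewrite -hd.
by apply: run_cons => //; rewrite hd.
Qed.

Lemma carry_cross (T : Type) (l1 l2 : seq T) a b :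
  carry (l1 ++ a :: b :: l2) (Crossing (size l1)) = l1 ++ b :: a :: l2.
Proof.
rewrite /= take_size_cat // drop_size_cat // -[(size l1).+2]add2n -drop_drop.
by rewrite drop_size_cat //= !drop0 take0.
Qed.

Lemma carry_rcusp (T : Type) (l1 l2 : seq T) a b :
  carry (l1 ++ a :: b :: l2) (RCusp (size l1)) = l1 ++ l2.
Proof.
rewrite /= take_size_cat // -[(size l1).+2]add2n -drop_drop.
by rewrite drop_size_cat //= drop0.
Qed.

Lemma cat_split2 (r : seq int) k : k.+1 < size r ->
  exists r1 x y r2, r = r1 ++ x :: y :: r2 /\ size r1 = k.
Proof.
move=> H; exists (take k r), (nth 0%R r k), (nth 0%R r k.+1), (drop k.+2 r).
by rewrite -!drop_nth ?cat_take_drop ?size_takel //; lia.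
Qed.

Lemma carry_shift rA rB r e : fits (size r) e ->
  carry (rA ++ r ++ rB) (shift_event (size rA) e) = rA ++ carry r e ++ rB :> seq int.
Proof.
case: e => k // ft; have [r1 [x [y [r2 [-> <-]]]]] := cat_split2 ft.
  rewrite -[Crossing _]/(Crossing _) carry_cross /shift_event -size_cat.
  by rewrite -catA catA carry_cross -!catA.
rewrite carry_rcusp /shift_event -size_cat.
by rewrite -catA catA carry_rcusp -!catA.
Qed.

(** This reduces the copies of a singularity of the companion to the two
    strands that meet there. *)
Lemma sweep_dsum d rA A rB B r f w r' g c :
  matching A -> matching B -> graded_row d rA A -> graded_row d rB B ->
  matching f -> sweep d r f w r' g c ->
  sweep d (rA ++ r ++ rB) (dsum A (dsum f B)) (map (shift_event (size A)) w)
    (rA ++ r' ++ rB) (dsum A (dsum g B)) c.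
Proof.
move=> mA mB gA gB mf H; elim: H mf => {r f w r' g c} [r f gr|r f e g w r' h c gr st _ IH] mf /=.
  apply: sweep_nil; apply: graded_dsum => //; last exact: matching_dsum.
  exact: graded_dsum.
have [ft _ _ mg _] := st.
rewrite -(switch_dsum_r B st) -(switch_dsum_l A).
apply: sweep_cons.
- apply: graded_dsum => //; last exact: matching_dsum.
  exact: graded_dsum.
- by apply: step_dsum_l => //; apply: step_dsum_r.
by rewrite -{1}(proj1 gA) carry_shift ?(proj1 gr) //; apply: IH.
Qed.

Lemma swapK k : involutive (swap k).
Proof. by move=> i; rewrite /swap; case_lia. Qed.

Lemma swapL k : swap k k = k.+1.
Proof. by rewrite /swap eqxx. Qed.

Lemma swapR k : swap k k.+1 = k.
Proof. by rewrite -[RHS](swapK k) swapL. Qed.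

Lemma swap_bound k m i : k.+1 < m -> (swap k i < m) = (i < m).
Proof. by rewrite /swap; case_lia. Qed.

Lemma ltn_swap k i j : ~~ ((i == k) && (j == k.+1)) ->
  ~~ ((i == k.+1) && (j == k)) -> (swap k i < swap k j) = (i < j).
Proof. by rewrite /swap; case_lia. Qed.

(** * Following labelled strands through crossings *)

Section Labels.

Variables (T : eqType) (potential : T -> int) (d : nat).
Implicit Types (l s : seq T) (tau : T -> T) (a b x : T).

(** A row is described by the list [l] of the labels of its strands from the
    top, a pairing by an involution [tau] of the labels.  Passing a crossing
    without a switch then changes only [l]. *)
Definition mates l tau : seq nat := [seq index (tau x) l | x <- l].

Definition paired l tau : Prop :=
  uniq l /\ {in l, forall x, [/\ tau x \in l, tau x != x & tau (tau x) = x]}.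

Definition ruled l tau : Prop := paired l tau /\ graded_row d (map potential l) (mates l tau).

(** Labels turn a sequence of crossings into a rearrangement of a list.  The
    hypothesis on the left end is part of [moves], so that consecutive moves
    compose without checking the intermediate rows. *)
Definition moves l tau w l' tau' c : Prop :=
  ruled l tau ->
  ruled l' tau' /\
  sweep d (map potential l) (mates l tau) w (map potential l') (mates l' tau') c.

Lemma size_mates l tau : size (mates l tau) = size l.
Proof. exact: size_map. Qed.

Lemma mate_mates l tau x : x \in l -> mate (mates l tau) (index x l) = index (tau x) l.
Proof. by move=> xl; rewrite /mate (nth_map x) ?index_mem ?nth_index. Qed.

Lemma matching_mates l tau : paired l tau -> matching (mates l tau).
Proof.
case=> ul H i; rewrite size_mates.
case: l ul H => [|x0 l'] // ul H; set l := x0 :: l' => Hi.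
have xl : nth x0 l i \in l by rewrite mem_nth.
have [a b c] := H _ xl; rewrite -(index_uniq x0 Hi ul).
rewrite !mate_mates // c index_mem a; split=> //.
by apply: contra b => /eqP/index_inj -> //.
Qed.

Lemma index_swap l1 l2 a b x : uniq (l1 ++ a :: b :: l2) ->
  index x (l1 ++ b :: a :: l2) = swap (size l1) (index x (l1 ++ a :: b :: l2)).
Proof.
rewrite cat_uniq => /and3P[_ _]; rewrite /= inE negb_or => /andP[/andP[ab _] _].
rewrite !index_cat /swap; case: ifP => [xl|_].
  by move: xl; rewrite -index_mem; case_lia.
rewrite /=; case: (eqVneq a x) => [<-|_]; case: (eqVneq b _) => [E|_]; try case_lia.
by rewrite E eqxx in ab.
Qed.

Lemma perm_swap l1 l2 a b : perm_eq (l1 ++ a :: b :: l2) (l1 ++ b :: a :: l2).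
Proof. by rewrite perm_cat2l -(cat1s a) -(cat1s b) (perm_catCA [:: a]). Qed.

Lemma paired_perm l l' tau : perm_eq l l' -> paired l tau -> paired l' tau.
Proof.
move=> P [ul H]; split; first by rewrite -(perm_uniq P).
by move=> x; rewrite -(perm_mem P) => /H; rewrite (perm_mem P).
Qed.

(** Strands that cross without being paired keep their partners.  The order of
    the two strands of a pair is unchanged as well, so the grading persists;
    and the partners of the two crossing strands are different, so the crossing
    cannot be read as a switch. *)
Lemma moves_cross l1 l2 a b tau : tau a != b ->
  moves (l1 ++ a :: b :: l2) tau [:: Crossing (size l1)]
        (l1 ++ b :: a :: l2) tau 0.
Proof.
move=> tab [pr gr]; set l := _ ++ a :: _ in pr gr *; set l' := _ ++ b :: _.
set k := size l1; have P : perm_eq l l' := perm_swap _ _ _ _.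
have [ul H] := pr; have pr' := paired_perm P pr.
have mf := matching_mates pr; have mg := matching_mates pr'.
have sl : size l' = size l by rewrite (perm_size P).
have al : a \in l by rewrite mem_cat inE eqxx orbT.
have bl : b \in l by rewrite mem_cat !inE eqxx !orbT.
have al1 : a \notin l1.
  by move: ul; rewrite cat_uniq /= => /and3P[_]; rewrite negb_or => /andP[].
have bl1 : b \notin l1.
  by move: ul; rewrite cat_uniq /= !negb_or => /and3P[_ /and3P[]].
have ab : a != b.
  move: ul; rewrite cat_uniq => /and3P[_ _].
  by rewrite /= inE negb_or => /andP[/andP[]].
have ia : index a l = k by rewrite index_cat (negPf al1) /= eqxx addn0.
have ib : index b l = k.+1.
  by rewrite index_cat (negPf bl1) /= (negPf ab) eqxx addn1.
have idx x : index x l' = swap k (index x l) by apply: index_swap.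
have k1 : k.+1 < size l by rewrite size_cat /= !addnS !ltnS leq_addr.
pose f := mates l tau; pose g := mates l' tau.
have sf : size f = size l := size_mates _ _.
have sg : size g = size l by rewrite size_mates.
have fg i : i < size l -> mate g (swap k i) = swap k (mate f i).
  move=> Hi; have xl : nth a l i \in l by rewrite mem_nth.
  rewrite -(index_uniq a Hi ul) -idx !mate_mates -?(perm_mem P) //.
have Ha : mate f k = index (tau a) l by rewrite -ia mate_mates.
have Hb : mate f k.+1 = index (tau b) l by rewrite -ib mate_mates.
have fk : mate f k != k.+1.
  rewrite Ha -ib; apply: contra tab => /eqP/index_inj -> //.
  by have [] := H _ al.
have {}mf : matching f by [].
have [|fk1 fk2 fk3] := mf k; first by rewrite sf ltnW.
have [|fk4 fk5 fk6] := mf k.+1; first by rewrite sf.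
have gk : mate g k = swap k (mate f k.+1).
  by rewrite -fg // swapR.
have fk7 : mate f k.+1 != k.
  by apply: contra_neqN fk => /eqP E; move: fk6; rewrite E.
have st : step (Crossing k) f g.
  split=> //=; rewrite ?sf ?sg //.
  rewrite fk gk /=; apply/andP; split.
    by rewrite -[X in _ != X]swapL (can_eq (swapK k)).
  apply/orP; left; apply/followsP => i i' Hi Hi' /eqP ->.
  by rewrite /= fg.
have sw : switch_at (Crossing k) f g = false.
  apply/negP => /turnsP/(_ k); rewrite sf => /(_ (ltnW k1)).
  rewrite gk /swap (negPf fk7) (negPf fk5) => E.
  by move: fk3; rewrite E fk6 => /eqP; rewrite -[X in _ == X]addn0 -addn1 eqn_add2l.
have nr i : i < size l -> nth 0%R (map potential l') (swap k i) = nth 0%R (map potential l) i.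
  move=> Hi; have si : swap k i < size l' by rewrite sl swap_bound.
  rewrite !(nth_map a) //; congr potential.
  rewrite -{1}(index_uniq a Hi ul) -idx nth_index //.
  by rewrite -(perm_mem P) mem_nth.
have gr' : graded_row d (map potential l') (mates l' tau).
  have [_ Hgr] := gr; split; first by rewrite size_map size_mates.
  rewrite size_mates sl => i; rewrite -[i](swapK k); move: (swap k i) => {}i Hi.
  rewrite swap_bound // in Hi.
  have [m1 m2 m3] := mf _ (etrans (congr1 _ sf) Hi).
  rewrite sf in m1; rewrite fg // !nr // ltn_swap.
  - by apply: Hgr; rewrite size_mates.
  - by apply: contra fk => /andP[/eqP ->].
  - by apply: contra fk7 => /andP[/eqP ->].
split; first by [].
have -> : 0 = switch_at (Crossing k) f g + 0 by rewrite sw.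
apply: sweep_cons => //.
have -> : carry (map potential l) (Crossing k) = map potential l'.
  by rewrite /l /l' !map_cat !map_cons /k -(size_map potential l1) carry_cross.
exact: sweep_nil.
Qed.

Definition exchange a b x := if x == a then b else if x == b then a else x.

Lemma exchangeK a b : involutive (exchange a b).
Proof.
move=> x; rewrite /exchange; case: (eqVneq x a) => [->|xa].
  by rewrite eqxx; case: eqVneq.
by case: (eqVneq x b) => [->|xb]; rewrite ?eqxx // (negPf xa) (negPf xb).
Qed.

Lemma map_exchange a b s : a \notin s -> b \notin s ->
  map (exchange a b) s = s.
Proof.
move=> ha hb; rewrite -[RHS]map_id; apply/eq_in_map => x xs.
rewrite /exchange; case: eqP xs ha => [-> ->//|_]; case: eqP hb => // -> hb xs.
by rewrite xs in hb.
Qed.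

(** At a switch the positions keep their partners while the labels [a] and
    [b] change places, so [tau'] is [tau] conjugated by the exchange of [a] and
    [b].  The partner of [a] lies above and that of [b] below, so the two
    intervals are disjoint and the switch is normal.  Positions [size l1] and
    [(size l1).+1] exchange their potentials, hence the condition on
    [potential]. *)
Lemma moves_switch l1 l2 a b tau tau' :
  tau a \in l1 -> tau b \in l2 ->
  (potential a == potential b %[mod d])%Z ->
  {in l1 ++ a :: b :: l2, forall x,
     tau' (exchange a b x) = exchange a b (tau x)} ->
  moves (l1 ++ a :: b :: l2) tau [:: Crossing (size l1)]
        (l1 ++ b :: a :: l2) tau' 1.
Proof.
move=> ta tb pab ht [pr gr].
set l := _ ++ a :: _ in ht pr gr *; set l' := _ ++ b :: _.
set k := size l1; have P : perm_eq l l' := perm_swap _ _ _ _.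
have [ul H] := pr; have mf := matching_mates pr.
have sl : size l' = size l by rewrite (perm_size P).
have al : a \in l by rewrite mem_cat inE eqxx orbT.
have bl : b \in l by rewrite mem_cat !inE eqxx !orbT.
have [al1 bl1] : a \notin l1 /\ b \notin l1.
  move: ul; rewrite cat_uniq /= !negb_or.
  by case/and3P=> _ /andP[? /andP[? _]] _.
have [ab al2 bl2] : [/\ a != b, a \notin l2 & b \notin l2].
  move: ul; rewrite cat_uniq => /and3P[_ _].
  by rewrite /= inE negb_or => /and3P[/andP[? ?] ? _].
have l'E : l' = map (exchange a b) l.
  rewrite map_cat /= !map_exchange // /exchange !eqxx eq_sym.
  by rewrite (negPf ab).
have ei : injective (exchange a b) := inv_inj (exchangeK a b).
have el x : x \in l -> exchange a b x \in l.
  by move=> xl; rewrite (perm_mem P) l'E map_f.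
have plE : mates l' tau' = mates l tau.
  transitivity (map (fun x => index (tau' x) l') (map (exchange a b) l)).
    by rewrite -l'E.
  rewrite -map_comp; apply/eq_in_map => x xl /=.
  by rewrite ht // l'E index_map.
have pr' : paired l' tau'.
  split; first by rewrite -(perm_uniq P).
  move=> x; rewrite -(perm_mem P) => xl; rewrite -(perm_mem P).
  have yl := el _ xl; have [t1 t2 t3] := H _ yl.
  have xE : x = exchange a b (exchange a b x) by rewrite exchangeK.
  move: (exchange a b x) xE yl t1 t2 t3 => y -> yl t1 t2 t3.
  by rewrite ht // ht // t3 (inj_eq ei) -ht //; split; rewrite // ht // el.
have ia : index a l = k by rewrite index_cat (negPf al1) /= eqxx addn0.
have ib : index b l = k.+1.
  by rewrite index_cat (negPf bl1) /= (negPf ab) eqxx addn1.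
have k1 : k.+1 < size l by rewrite size_cat /= !addnS !ltnS leq_addr.
pose f := mates l tau.
have sf : size f = size l := size_mates _ _.
have Ha : mate f k < k.
  by rewrite -{1}ia mate_mates // index_cat ta /k index_mem.
have Hb : k.+1 < mate f k.+1.
  rewrite -{2}ib mate_mates // index_cat ifN.
    rewrite /=; case: eqP => [E|_]; first by rewrite E tb in al2.
    by case: eqP => [E|_]; [rewrite E tb in bl2|rewrite !addnS !ltnS leq_addr].
  move: ul; rewrite cat_uniq => /and3P[_ /hasPn Hn _].
  by apply: (Hn (tau b)); rewrite !inE tb !orbT.
have st : step (Crossing k) f f.
  split=> //=; rewrite ?sf //; rewrite neq_ltn (ltn_trans Ha) //=.
  apply/orP; right; apply/andP; split; first by apply/turnsP.
  by rewrite /normal (maxn_idPl (ltnW Ha)) (minn_idPl (ltnW Hb)) ltnSn.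
have sw : switch_at (Crossing k) f f by apply/turnsP.
have pm i : i < size l -> (nth 0%R (map potential l') i == nth 0%R (map potential l) i %[mod d])%Z.
  move=> Hi; rewrite !(nth_map a) ?sl // l'E (nth_map a) // /exchange.
  case: (eqVneq (nth a l i) a) => [->|_]; first by rewrite eq_sym.
  by case: (eqVneq (nth a l i) b) => [->|_].
have gr' : graded_row d (map potential l') (mates l' tau').
  have [_ Hgr] := gr; rewrite plE; split; first by rewrite size_map sf.
  rewrite -/f => i Hi lt; have [m1 _ _] := mf _ Hi.
  rewrite (eqP (pm _ _)) -?sf // -modzDml (eqP (pm _ _)) -?sf // modzDml.
  exact: Hgr.
split=> //; rewrite plE.
have -> : 1 = switch_at (Crossing k) f f + 0 by rewrite sw.
apply: sweep_cons => //.
have -> : carry (map potential l) (Crossing k) = map potential l'.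
  by rewrite /l /l' !map_cat !map_cons /k -(size_map potential l1) carry_cross.
by apply: sweep_nil; move: gr'; rewrite plE.
Qed.

Lemma moves_nil l tau : moves l tau [::] l tau 0.
Proof. by case=> pr gr; split=> //; apply: sweep_nil. Qed.

Lemma moves_ruled l t w l' t' c : (ruled l t -> moves l t w l' t' c) ->
  moves l t w l' t' c.
Proof. by move=> H rl; apply: H. Qed.

Lemma moves_cat l1 t1 w1 l2 t2 c1 w2 l3 t3 c2 :
  moves l1 t1 w1 l2 t2 c1 -> moves l2 t2 w2 l3 t3 c2 ->
  moves l1 t1 (w1 ++ w2) l3 t3 (c1 + c2).
Proof.
move=> H1 H2 /H1[/H2[ok3 S2] S1]; split=> //; exact: sweep_cat S1 S2.
Qed.

(** The partner of the rising strand is not in the block [s], so no pair meets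
    at these crossings. *)
Lemma moves_up l1 s b l2 tau : tau b \notin s ->
  moves (l1 ++ s ++ b :: l2) tau
        [seq Crossing (size l1 + size s - u).-1 | u <- iota 0 (size s)]
        (l1 ++ b :: s ++ l2) tau 0.
Proof.
elim/last_ind: s l2 => [|s a IH] l2 tb; first exact: moves_nil.
rewrite mem_rcons inE negb_or in tb; case/andP: tb => tba tb.
rewrite size_rcons /= -!cats1 -!catA !cat1s; apply: moves_ruled => rl.
have tab : tau a != b.
  have [[_ H] _] := rl; apply: contra tba => /eqP <-.
  by have [|_ _ ->] := H a; rewrite ?mem_cat ?inE ?eqxx ?orbT.
rewrite catA -[X in moves _ _ _ _ _ X]add0n -[_ :: map _ _]cat1s.
apply: moves_cat.
  by rewrite subn0 addnS -size_cat; apply: moves_cross tab.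
rewrite -catA (iotaDl 1 0) -map_comp.
have -> : map ((fun u => Crossing (size l1 + (size s).+1 - u).-1) \o addn 1) (iota 0 (size s))
        = [seq Crossing (size l1 + size s - u).-1 | u <- iota 0 (size s)].
  by apply: eq_map => u /=; congr Crossing; lia.
exact: IH.
Qed.

Lemma moves_down l1 a s l2 tau : tau a \notin s ->
  moves (l1 ++ a :: s ++ l2) tau
        [seq Crossing (size l1 + v) | v <- iota 0 (size s)]
        (l1 ++ s ++ a :: l2) tau 0.
Proof.
elim: s l1 => [|b s IH] l1 ta; first exact: moves_nil.
rewrite inE negb_or in ta; case/andP: ta => tab ta.
rewrite /= -[X in moves _ _ _ _ _ X]add0n -[_ :: map _ _]cat1s.
apply: moves_cat; first by rewrite addn0; apply: moves_cross tab.
rewrite (iotaDl 1 0) -map_comp -cat_rcons -[l1 ++ b :: _]cat_rcons.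
have -> : map ((fun v => Crossing (size l1 + v)) \o addn 1) (iota 0 (size s))
        = [seq Crossing (size (rcons l1 b) + v) | v <- iota 0 (size s)].
  by apply: eq_map => u /=; congr Crossing; rewrite size_rcons; lia.
exact: IH.
Qed.

End Labels.

(** * The copies of one crossing or one cusp *)

Definition copies (m : nat) (f : seq nat) : seq nat := iter m (dsum f) [::].

Lemma copiesD a b f : copies (a + b) f = dsum (copies a f) (copies b f).
Proof.
elim: a => [|a IH]; first by rewrite dsum0f.
by rewrite addSn /copies !iterS -/(copies _ _) IH dsumA.
Qed.

Lemma copies1 f : copies 1 f = f.
Proof. exact: dsumf0. Qed.

Lemma size_copies m f : size (copies m f) = size f * m.
Proof. by elim: m => [|m IH]; rewrite ?muln0 //= size_dsum IH mulnS. Qed.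

Lemma matching_copies m f : matching f -> matching (copies m f).
Proof. by move=> mf; elim: m => [|m IH] //=; apply: matching_dsum. Qed.

Lemma mates_cat (T : eqType) (l1 l2 : seq T) tau :
  {in l1, forall x, tau x \in l1} -> {in l2, forall x, tau x \notin l1} ->
  mates (l1 ++ l2) tau = dsum (mates l1 tau) (mates l2 tau).
Proof.
move=> H1 H2; rewrite /mates map_cat /dsum -map_comp size_map; congr (_ ++ _).
  by apply/eq_in_map => x /H1 xl; rewrite index_cat xl.
by apply/eq_in_map => x /H2 xl /=; rewrite index_cat (negPf xl).
Qed.

Lemma moves_ext (T : eqType) (potential : T -> int) d l tau w l' tau' tau'' c :
  {in l', tau' =1 tau''} -> moves potential d l tau w l' tau' c ->
  moves potential d l tau w l' tau'' c.
Proof.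
move=> E H rl; have [[[ul Hl] gr] S] := H rl.
have pE : mates l' tau' = mates l' tau''.
  by apply/eq_in_map => x xl; rewrite E.
split; last by rewrite -pE.
split; last by rewrite -pE.
split=> // x xl; have [a b c'] := Hl _ xl.
by rewrite -!E.
Qed.

Section TwoStrands.

Variables (d : nat) (f0 : seq nat) (e : seq int) (x y : int).
Hypotheses (mf : matching f0) (ge : graded_row d e f0).

Local Notation n := (size f0).

(** The label [(b, j)] stands for copy [j] of one of the two strands that
    meet at the singularity of the companion: the upper one if [b] is true, the
    lower one otherwise; [x] and [y] are their potentials, and [e] and [f0] the
    potentials and the pairing of the pattern over x = 0. *)
Definition potential (s : bool * nat) : int :=
  ((if s.1 then x else y) + nth 0 e s.2)%R.

Definition strands b i m : seq (bool * nat) := [seq (b, j) | j <- iota i m].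

(** [R] singles out the indices whose two copies are already paired with each
    other, as a cusp requires; the other labels are paired as in the pattern. *)
Definition tau (R : nat -> bool) (s : bool * nat) : bool * nat :=
  if R s.2 then (~~ s.1, s.2) else (s.1, mate f0 s.2).

Lemma size_strands b i m : size (strands b i m) = m.
Proof. by rewrite size_map size_iota. Qed.

Lemma mem_strands b i m c j :
  ((c, j) \in strands b i m) = (c == b) && (i <= j < i + m).
Proof.
rewrite -mem_iota; apply/mapP/andP => [[k ki [-> ->]]|[/eqP -> ji]] //.
by exists j.
Qed.

Lemma strandsS b i m : strands b i m.+1 = (b, i) :: strands b i.+1 m.
Proof. by []. Qed.

Lemma strandsD b i m m' :
  strands b i (m + m') = strands b i m ++ strands b (i + m) m'.
Proof. by rewrite /strands iotaD map_cat. Qed.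

Lemma strands_rcons b m : strands b 0 m.+1 = rcons (strands b 0 m) (b, m).
Proof. by rewrite -addn1 strandsD cats1. Qed.

Lemma uniq_strands b i m : uniq (strands b i m).
Proof. by rewrite map_inj_uniq ?iota_uniq // => ? ? []. Qed.

Lemma index_strands b m j : j < m -> index (b, j) (strands b 0 m) = j.
Proof.
move=> jm; rewrite /strands index_map; last by move=> ? ? [].
have {1}<- : nth 0 (iota 0 m) j = j by rewrite nth_iota.
by rewrite index_uniq ?size_iota ?iota_uniq.
Qed.

Lemma map_mate : map (mate f0) (iota 0 n) = f0.
Proof.
apply: (@eq_from_nth _ 0); rewrite size_map size_iota // => i Hi.
rewrite (nth_map 0) ?size_iota // nth_iota // /mate.
exact: set_nth_default.
Qed.

Lemma mates_strands b : mates (strands b 0 n) (tau pred0) = f0.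
Proof.
rewrite -[RHS]map_mate /mates /strands -map_comp.
apply/eq_in_map => i; rewrite mem_iota => /andP[_ Hi] /=.
by rewrite index_strands //; have [] := mf Hi.
Qed.

Lemma mates_two b :
  mates (strands b 0 n ++ strands (~~ b) 0 n) (tau pred0) = dsum f0 f0.
Proof.
rewrite mates_cat ?mates_strands // => -[c i]; rewrite mem_strands /tau /=.
  by case/andP=> cb Hi; rewrite mem_strands cb; have [->] := mf Hi.
by case/andP=> /eqP -> _; rewrite mem_strands; case: (b).
Qed.

Lemma paired_two b : paired (strands b 0 n ++ strands (~~ b) 0 n) (tau pred0).
Proof.
split.
  rewrite cat_uniq !uniq_strands andbT; apply/hasPn => -[c i].
  by rewrite !mem_strands => /andP[/eqP -> _]; case: (b).
move=> [c i]; rewrite mem_cat !mem_strands /= -andb_orl => /andP[cb Hi].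
have [h1 h2 h3] := mf Hi.
rewrite /tau /= mem_cat !mem_strands -andb_orl cb h1 h3; split=> //.
by apply: contra h2 => /eqP [->].
Qed.

Lemma graded_shift z : graded_row d [seq (z + t)%R | t <- e] f0.
Proof.
have [se He] := ge; split=> [|i Hi lt]; first by rewrite size_map.
have [h1 _ _] := mf Hi.
by rewrite !(nth_map 0%R) ?se // -addrA eqz_modDl He.
Qed.

Lemma map_potential_strands b :
  map potential (strands b 0 n) = [seq ((if b then x else y) + t)%R | t <- e].
Proof.
have [se _] := ge.
rewrite /strands -map_comp -[in RHS](mkseq_nth 0%R e) /mkseq -map_comp se.
by apply: eq_map.
Qed.

Lemma ruled_two b : ruled potential d (strands b 0 n ++ strands (~~ b) 0 n) (tau pred0).
Proof.
split; first exact: paired_two.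
rewrite mates_two map_cat !map_potential_strands.
by apply: graded_dsum => //; apply: graded_shift.
Qed.

Definition pair_rows : seq int := [seq (x + t)%R | t <- e] ++ [seq (y + t)%R | t <- e].

(** The lower copies rise one after the other above all upper ones; the row on
    the left is the one reached when [t] of them have done so.  A rising copy
    never meets its partner, which is a copy of the same strand. *)
Lemma moves_crossing m t : t + m = n ->
  moves potential d (strands false 0 t ++ strands true 0 n ++ strands false t m)
    (tau pred0)
    [seq Crossing (n + t - u).-1 | t <- iota t m, u <- iota 0 n]
    (strands false 0 n ++ strands true 0 n) (tau pred0) 0.
Proof.
elim: m t => [|m IH] t tm.
  by rewrite cats0 -tm addn0; apply: moves_nil.
rewrite strandsS allpairs_cons.
rewrite -[X in moves _ _ _ _ _ _ _ X]add0n.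
have nb : tau pred0 (false, t) \notin strands true 0 n by rewrite mem_strands.
have := @moves_up _ potential d (strands false 0 t) _ _ (strands false t.+1 m) _ nb.
rewrite !size_strands => M; apply: moves_cat.
  rewrite (_ : map _ _ = [seq Crossing (t + n - u).-1 | u <- iota 0 n]).
    exact: M.
  by apply: eq_map => u; rewrite (addnC n).
by rewrite -cat_rcons -strands_rcons; apply: IH; rewrite addSnnS.
Qed.

Lemma sweep_crossing : exists r,
  sweep d pair_rows (dsum f0 f0) (copy n (Crossing 0)) r (dsum f0 f0) 0.
Proof.
have [_] := moves_crossing (add0n n) (ruled_two true).
rewrite (mates_two true) (mates_two false) !map_cat !map_potential_strands /=.
rewrite (_ : [seq _ | t <- _, u <- _] = copy n (Crossing 0)) => [S|].
  by eexists; exact: S.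
by rewrite /= muln0.
Qed.

Hypothesis xy : (x == y + 1 %[mod d])%Z.

(** The crossings at a right cusp are taken for decreasing [t], the strand
    U_t sinking below L_0, ..., L_(t-1).  The pair of indices [i] and
    [mate f0 i] is dealt with while the larger of the two sinks. *)
Definition settled (t i : nat) : bool := t <= maxn i (mate f0 i).

Definition zigzag i m : seq (bool * nat) :=
  flatten [seq [:: (true, j); (false, j)] | j <- iota i m].

(** The row left once only [t] upper strands are still to sink: below
    U_0, ..., U_(t-1) and L_0, ..., L_(t-1), the later strands already
    alternate, ready for their cusps. *)
Definition merged t m : seq (bool * nat) :=
  strands true 0 t ++ strands false 0 t ++ zigzag t m.

Lemma mem_zigzag c j i m : ((c, j) \in zigzag i m) = (i <= j < i + m).
Proof.
rewrite -mem_iota; apply/flatten_mapP/idP => [[k ki]|ji].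
  by rewrite !inE => /orP[] /eqP[_ ->].
by exists j => //; rewrite !inE; case: c; rewrite eqxx ?orbT.
Qed.

Lemma mem_merged c j t m : t + m = n -> (c, j) \in merged t m -> j < n.
Proof.
move=> tm; rewrite !mem_cat !mem_strands mem_zigzag -tm.
by case/or3P=> [/andP[_]||] H; lia.
Qed.

(** The switch of U_t with L_v, where [v] is paired with [t], has the effect
    of declaring [t] and [v] settled. *)
Lemma tau_exchange t v c i : t < n -> mate f0 t = v -> v < t -> i < n ->
  tau (settled t) (exchange (true, t) (false, v) (c, i)) =
  exchange (true, t) (false, v) (tau (settled t.+1) (c, i)).
Proof.
move=> tn tv vt Hi; have [_ _] := mf tn; rewrite tv => vt'.
have [in1 in2 in3] := mf Hi.
have lt0 : settled t t by rewrite /settled leq_maxl.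
have lt1 : settled t.+1 t = false by rewrite /settled tv (maxn_idPl (ltnW vt)) ltnn.
have lv0 : settled t v by rewrite /settled vt' leq_maxr.
have lv1 : settled t.+1 v = false by rewrite /settled vt' (maxn_idPr (ltnW vt)) ltnn.
have tv' : (t == v) = false by apply/eqP => E; rewrite E ltnn in vt.
have vt2 : (v == t) = false by rewrite eq_sym.
have ex b j : exchange (true, t) (false, v) (b, j) =
    if b && (j == t) then (false, v) else
    if ~~ b && (j == v) then (true, t) else (b, j).
  rewrite /exchange !xpair_eqE; by case: b.
rewrite ex; case: (eqVneq i t) => [->|it].
  rewrite /tau [RHS]/= lt1 tv ex !tv' !andbF vt2 !andbF /= .
  by case: c; rewrite /= ?lv0 ?lt0 ?eqxx //= ?vt2 ?tv'.
case: (eqVneq i v) => [->|iv].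
  rewrite /tau /= lv1 vt' !andbF !andbT ex eqxx tv' andbF andbT.
  by case: c; rewrite /= ?lv0 ?lt0.
have pit : mate f0 i != t.
  by apply: contra_neq iv => E; rewrite -in3 E tv.
have piv : mate f0 i != v.
  by apply: contra_neq it => E; rewrite -in3 E vt'.
have ll : settled t.+1 i = settled t i.
  rewrite /settled ltn_neqAle eq_sym; case: (t <= _); rewrite ?andbF // andbT.
  by rewrite /maxn; case: ifP => _; rewrite ?pit ?it.
rewrite !andbF /tau /= ll; case: (settled t i) => /=; rewrite ex.
  by rewrite (negPf it) (negPf iv) !andbF.
by rewrite (negPf pit) (negPf piv) !andbF.
Qed.

(** U_t sinks past L_0, ..., L_(t-1).  If its index is paired with a smaller
    one, [v], it switches with L_v.  Otherwise U_t is already paired with L_t,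
    and it meets no partner. *)
Lemma moves_row t m : t.+1 + m = n ->
  moves potential d (merged t.+1 m) (tau (settled t.+1))
    [seq Crossing (t + v) | v <- iota 0 t]
    (merged t m.+1) (tau (settled t)) (mate f0 t < t).
Proof.
move=> tm; have tn : t < n by rewrite -tm leq_addr.
have [pn ptt ppt] := mf tn.
have mE : merged t.+1 m = strands true 0 t ++ (true, t) ::
    (strands false 0 t ++ (false, t) :: zigzag t.+1 m).
  by rewrite /merged !strands_rcons !cat_rcons.
rewrite mE /merged; set Z := zigzag t.+1 m.
rewrite -[zigzag t m.+1]/((true, t) :: (false, t) :: Z).
have down l1 l2 s R : tau R (true, t) \notin s ->
    moves potential d (l1 ++ (true, t) :: s ++ l2) (tau R)
      [seq Crossing (size l1 + v) | v <- iota 0 (size s)]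
      (l1 ++ s ++ (true, t) :: l2) (tau R) 0.
  exact: moves_down.
case: (ltngtP (mate f0 t) t) ptt => // vt _; last first.
  have tl : tau (settled t.+1) (true, t) \notin strands false 0 t.
    by rewrite /tau /settled leq_max vt orbT /= mem_strands ltnn andbF.
  have := down (strands true 0 t) ((false, t) :: Z) _ _ tl.
  rewrite !size_strands; apply: moves_ext => -[c i] H.
  have Hi : i < n.
    apply: (@mem_merged c i t.+1 m) => //; rewrite mE.
    move: H; rewrite !mem_cat !inE mem_cat !inE.
    by case/or4P => [->|->|->|/orP[->|->]]; rewrite ?orbT.
  rewrite /tau /=.
  (* The indices settled before and after are the same: a newly settled pair
     would have t as its larger member, while t is paired with a larger index. *)
  suff -> : settled t.+1 i = settled t i by [].
  rewrite /settled ltn_neqAle eq_sym; case: (t <= _); rewrite ?andbF // andbT.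
  have [_ _ in3] := mf Hi.
  rewrite /maxn; case: ltnP => Hm; apply/eqP => E.
    by move: Hm; rewrite E -in3 E; rewrite ltnNge ltnW.
  by move: Hm; rewrite E leqNgt vt.
(* U_t goes past L_0, ..., L_(v-1), switches with L_v, and then goes past
   L_(v+1), ..., L_(t-1) with L_t as its partner. *)
set v := mate f0 t in vt pn ppt *.
have lt1 : settled t.+1 t = false by rewrite /settled -/v (maxn_idPl (ltnW vt)) ltnn.
have lv1 : settled t.+1 v = false by rewrite /settled ppt (maxn_idPr (ltnW vt)) ltnn.
have sE : strands false 0 t =
    strands false 0 v ++ (false, v) :: strands false v.+1 (t - v.+1).
  by rewrite -strandsS -strandsD; congr strands; rewrite -subSn // subSS subnKC // ltnW.
set s1 := strands false 0 v in sE; set s2 := strands false v.+1 _ in sE.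
have E0 : [seq Crossing (t + u) | u <- iota 0 t] =
    [seq Crossing (t + u) | u <- iota 0 v] ++ [:: Crossing (t + v)] ++
    [seq Crossing (t + v.+1 + u) | u <- iota 0 (t - v.+1)].
  rewrite -{2}(subnKC vt) iotaD -addn1 iotaD !map_cat -!catA; congr (_ ++ _).
  congr (_ ++ _); rewrite add0n -[v + 1]addn0 iotaDl -map_comp.
  by apply: eq_map => u /=; rewrite addn0 addnA.
rewrite E0 sE -!catA -[X in moves _ _ _ _ _ _ _ X]add0n.
apply: moves_cat.
  have tl : tau (settled t.+1) (true, t) \notin s1.
    by rewrite /tau lt1 /= mem_strands.
  have := down (strands true 0 t) ((false, v) :: s2 ++ (false, t) :: Z) _ _ tl.
  by rewrite !size_strands; apply.
rewrite -[X in moves _ _ _ _ _ _ _ X]addn0; apply: (moves_cat (t2 := tau (settled t))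
  (l2 := strands true 0 t ++ s1 ++ (false, v) :: (true, t) :: s2 ++ (false, t) :: Z)).
  have := @moves_switch _ potential d (strands true 0 t ++ s1)
    (s2 ++ (false, t) :: Z) (true, t) (false, v) (tau (settled t.+1)) (tau (settled t)).
  rewrite size_cat !size_strands -!catA /=; apply.
  - by rewrite /tau lt1 /= mem_cat mem_strands /= add0n vt.
  - by rewrite /tau lv1 /= ppt mem_cat inE eqxx orbT.
  - have [_ /(_ v pn)] := ge; rewrite ppt => /(_ vt) ev.
    rewrite /potential /= -modzDml (eqP xy) modzDml -addrA eqz_modDl addrC.
    by rewrite eq_sym.
  - move=> [c i] H; apply: tau_exchange => //.
    apply: (@mem_merged c i t.+1 m) => //; rewrite mE sE.
    by rewrite -!catA in H *; move: H; rewrite !(mem_cat, inE);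
      do ?case: (_ \in _); do ?case: (_ == _).
have tl : tau (settled t) (true, t) \notin s2.
  by rewrite /tau /settled leq_maxl /= mem_strands subnKC // ltnn andbF.
have := down (strands true 0 t ++ s1 ++ [:: (false, v)]) ((false, t) :: Z) _ _ tl.
by rewrite !size_cat !size_strands addn1 -!catA.
Qed.

Lemma moves_rows t m : t + m = n ->
  moves potential d (merged t m) (tau (settled t))
    (rev [seq Crossing (2 * i - u).-1 | i <- iota 0 t, u <- iota 0 i])
    (merged 0 n) (tau (settled 0))
    (count (fun i => mate f0 i < i) (iota 0 t)).
Proof.
elim: t m => [|t IH] m tm; first by rewrite -tm; apply: moves_nil.
rewrite -[in iota 0 t.+1]addn1 iotaD map_cat flatten_cat rev_cat count_cat /= cats0 addn0 add0n.
rewrite addnC; apply: moves_cat (IH m.+1 _); last by rewrite addnS -addSn.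
rewrite (_ : rev _ = [seq Crossing (t + v) | v <- iota 0 t]).
  exact: moves_row.
apply: (@eq_from_nth _ (Crossing 0)); rewrite size_rev !size_map // size_iota => i Hi.
rewrite nth_rev ?size_map ?size_iota // !(nth_map 0) ?size_iota ?nth_iota //; try lia.
congr Crossing; lia.
Qed.

(** Every index satisfies [settled 0], so each upper strand is paired with the
    lower strand just below it. *)
Lemma mates_zigzag m : mates (zigzag 0 m) (tau (settled 0)) = copies m [:: 1; 0].
Proof.
elim: m => [|m IH] //; rewrite /zigzag -addn1 iotaD map_cat flatten_cat -/(zigzag 0 m).
rewrite copiesD copies1 -IH mates_cat.
- by congr dsum; rewrite /mates /= /tau /= !eqxx.
- by case=> c j; rewrite /tau /settled /= !mem_zigzag.
- case=> c j; rewrite /tau /settled /= mem_zigzag !inE /=.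
  by case/orP => /eqP[_ ->]; rewrite ltnn.
Qed.

Lemma step_end_rcusp f : matching f ->
  step (RCusp (size f)) (dsum f [:: 1; 0]) f.
Proof.
move=> mf'; rewrite -{3}[f]dsumf0 -[size f]addn0.
apply: (@step_dsum_l f (RCusp 0)) => //; split=> //.
  by case=> [|[|]].
by apply/followsP => i i' _.
Qed.

(** The cusps are taken from the bottom up, so each closes the last two
    strands of the row. *)
Lemma sweep_rcusps m :
  sweep d (map potential (zigzag 0 m)) (copies m [:: 1; 0])
    (rev [seq RCusp (2 * i) | i <- iota 0 m]) [::] [::] 0.
Proof.
have m10 : matching [:: 1; 0] by case=> [|[|]].
have gz k : graded_row d (map potential (zigzag 0 k)) (copies k [:: 1; 0]).
  elim: k => [|k IH] //; rewrite /zigzag -addn1 iotaD map_cat flatten_cat map_cat.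
  rewrite copiesD copies1; apply: graded_dsum => //; last exact: matching_copies.
  split=> // -[|[|i]] //= _ _; rewrite /potential /= /mate /=.
  by rewrite -modzDml (eqP xy) modzDml addrAC.
elim: m => [|m IH]; first by apply: sweep_nil.
have mm : matching (copies m [:: 1; 0]) by apply: matching_copies.
have sz : size (copies m [:: 1; 0]) = 2 * m by rewrite size_copies.
have gS := gz m.+1; move: gS.
rewrite -addn1 copiesD copies1 iotaD map_cat rev_cat /= => gS.
have st := step_end_rcusp mm.
rewrite -[0]/(switch_at (RCusp (2 * m)) (dsum (copies m [:: 1; 0]) [:: 1; 0])
                (copies m [:: 1; 0]) + 0).
apply: sweep_cons; rewrite -?sz // sz.
rewrite (_ : carry _ _ = map potential (zigzag 0 m)); first exact: IH.
have <- : size (map potential (zigzag 0 m)) = 2 * m by have [-> _] := gz m.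
rewrite /zigzag iotaD map_cat flatten_cat map_cat.
exact: etrans (carry_rcusp _ [::] _ _) (cats0 _).
Qed.

Lemma sweep_rcusp :
  sweep d pair_rows (dsum f0 f0) (copy n (RCusp 0)) [::] [::]
    (count (fun i => mate f0 i < i) (iota 0 n)).
Proof.
have l0E : merged n 0 = strands true 0 n ++ strands false 0 n.
  by rewrite /merged cats0.
have late0 b : {in strands b 0 n, tau (settled n) =1 tau pred0}.
  move=> [c i]; rewrite mem_strands add0n => /and3P[_ _ Hi]; rewrite /tau /settled /=.
  by have [h _ _] := mf Hi; rewrite leqNgt gtn_max Hi h.
have plE : mates (merged n 0) (tau (settled n)) = dsum f0 f0.
  rewrite -(mates_two true) l0E /mates; apply/eq_in_map => s.
  by rewrite mem_cat => /orP[] /late0 ->.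
have okm : ruled potential d (merged n 0) (tau (settled n)).
  have [[ul Hl] gr] := ruled_two true.
  split; last by rewrite plE -(mates_two true) l0E.
  rewrite l0E; split=> // s sl; have [h1 h2 h3] := Hl _ sl.
  have E z : z \in strands true 0 n ++ strands false 0 n ->
      tau (settled n) z = tau pred0 z.
    by rewrite mem_cat => /orP[] /late0.
  by rewrite !(E s) // E.
have [_ S] := moves_rows (addn0 n) okm.
rewrite plE l0E map_cat !map_potential_strands mates_zigzag in S.
have := sweep_cat S (sweep_rcusps n); rewrite addn0.
rewrite /copy /copy_lcusp muln0 /mirror map_cat rev_cat.
rewrite -[map mirror_event (map _ _)]map_comp.
rewrite map_flatten -map_comp.
rewrite (_ : flatten _ = [seq Crossing (2 * i - u).-1 | i <- iota 0 n, u <- iota 0 i]) //.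
by congr flatten; apply: eq_map => t /=; rewrite -map_comp.
Qed.

End TwoStrands.

(** * Rulings as ruled pieces *)

Section Rulings.

Variable F : front.
Local Notation N := (size (word F)).

Lemma width0 : width F 0 = base F.
Proof. by rewrite /width take0. Qed.

Lemma widthS j : j < N -> width F j.+1 = after (width F j) (ev F j).
Proof. by move=> jN; rewrite /width (take_nth (Crossing 0) jN) -cats1 foldl_cat. Qed.

Lemma partner_ord (rho : pairing F) (j : 'I_N.+1) (i : 'I_(width F j)) :
  partner rho j i = rho j i.
Proof. by rewrite /partner inord_val valK. Qed.

Lemma partner_out (rho : pairing F) j i : j <= N -> width F j <= i -> partner rho j i = i.
Proof.
move=> jN ji; rewrite /partner insubF // inordK //.
by apply/negbTE; rewrite -leqNgt.
Qed.

Definition ruling_mates (rho : pairing F) j : seq nat := mkseq (partner rho j) (width F j).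

Lemma mate_ruling_mates rho j i : j <= N -> mate (ruling_mates rho j) i = partner rho j i.
Proof.
move=> jN; case: (ltnP i (width F j)) => Hi; first by rewrite /mate nth_mkseq.
by rewrite mate_out ?size_mkseq // partner_out.
Qed.

Section FromRuling.

Variables (d : nat) (mu : nat -> nat -> int) (rho : pairing F).
Hypotheses (fF : is_front F) (nr : normal_ruling rho) (gr : graded d mu rho).

Lemma matching_ruling_mates j : j <= N -> matching (ruling_mates rho j).
Proof.
move=> jN i; rewrite size_mkseq => Hi; rewrite !mate_ruling_mates //.
have /and3P[/forallP/(_ (Ordinal (jN : j < N.+1)))/forallP/(_ (Ordinal Hi))] := nr.
have := @partner_ord rho (Ordinal (jN : j < N.+1)) => E.
case/andP => h1 /eqP h2 _ _.
have E1 := E (Ordinal Hi); have E2 := E (rho (Ordinal (jN : j < N.+1)) (Ordinal Hi)).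
by rewrite h2 /= in E1 E2; rewrite E1 E2; split.
Qed.

Lemma ruling_mates_last : ruling_mates rho N = ruling_mates rho 0.
Proof.
have [_ wN] := fF; rewrite /ruling_mates wN width0; apply/eq_in_map => i.
rewrite mem_iota add0n => /= Hi.
by have /and3P[_ /forallP/(_ (Ordinal Hi))/eqP ? _] := nr.
Qed.

Lemma eq_ruled_event e m m' f f' g g' : f =1 f' -> g =1 g' ->
  ruled_event e m m' f g = ruled_event e m m' f' g'.
Proof.
move=> ef eg.
have fo : follows e m m' f g = follows e m m' f' g'.
  by apply: eq_forallb => i; apply: eq_forallb => i'; rewrite ef eg.
have tu : turns m f g = turns m f' g' by apply: eq_forallb => i; rewrite ef eg.
by case: e fo => k /= ->; rewrite ?tu /normal ?ef ?eg.
Qed.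

Lemma step_ruling_mates j : j < N -> step (ev F j) (ruling_mates rho j) (ruling_mates rho j.+1).
Proof.
move=> jN; have [ft _] := fF; split; rewrite ?size_mkseq.
- exact: ft.
- exact: widthS.
- exact: matching_ruling_mates (ltnW jN).
- exact: matching_ruling_mates.
have /and3P[_ _ /forallP/(_ (Ordinal jN)) H] := nr.
rewrite -(eq_ruled_event _ _ _ (f := partner rho j) (g := partner rho j.+1)) // => i.
  by rewrite mate_ruling_mates // ltnW.
by rewrite mate_ruling_mates.
Qed.

Lemma graded_ruling_mates j : j <= N ->
  graded_row d [seq mu j i | i <- iota 0 (width F j)] (ruling_mates rho j).
Proof.
move=> jN; split; first by rewrite !size_map.
move=> i Hi; have [h1 _ _] := matching_ruling_mates jN Hi; move: Hi h1.
rewrite size_mkseq mate_ruling_mates // => Hi h1 lt.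
rewrite !(nth_map 0) ?size_iota // !nth_iota //.
have /forallP/(_ (Ordinal (jN : j < N.+1)))/forallP/(_ (Ordinal Hi))/implyP := gr.
exact.
Qed.

End FromRuling.

Lemma switches_ruling_mates (rho : pairing F) :
  switches rho = \sum_(0 <= j < N)
    switch_at (ev F j) (ruling_mates rho j) (ruling_mates rho j.+1).
Proof.
rewrite /switches cardsE -sum1_card big_mkord big_mkcond /=.
apply: eq_bigr => j _; rewrite unfold_in /is_switch /switch_at.
case: (ev F j) => // k; rewrite size_mkseq.
rewrite (_ : turns _ (mate _) _ = turns (width F j) (partner rho j) (partner rho j.+1)).
  by case: turns.
by apply: eq_forallb => i; rewrite !mate_ruling_mates // ltnW.
Qed.

(** A ruled piece that covers the whole word of the front and whose two ends
    carry the same pairing closes up to a ruling. *)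
Lemma ruling_of_run d mu rs fs g r c :
  run d rs fs (word F) g c -> head g fs = g -> size g = base F ->
  matching g -> graded_row d r g ->
  (forall j i, mu j i = nth 0%R (nth [::] (rcons rs r) j) i) ->
  exists rho : pairing F,
    [/\ normal_ruling rho && graded d mu rho, switches rho = c
      & forall j i, j <= N -> partner rho j i = mate (nth g fs j) i].
Proof.
move=> R hg sg mg gg muE; have [srs sfs] := run_size R.
have fN : nth g fs N = g by rewrite nth_default ?sfs.
have ms j : j <= N -> matching (nth g fs j).
  rewrite leq_eqVlt => /orP[/eqP ->|jN]; first by rewrite fN.
  by have [_ []] := run_nth R jN.
have sz j : j <= N -> size (nth g fs j) = width F j.
  elim: j => [|j IH] jN; first by rewrite nth0 hg width0.
  by rewrite widthS // -IH ?(ltnW jN) //; have [_ []] := run_nth R jN.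
have gs j : j <= N -> graded_row d (nth [::] (rcons rs r) j) (nth g fs j).
  rewrite nth_rcons srs leq_eqVlt => /orP[/eqP ->|jN].
    by rewrite ltnn eqxx fN.
  by rewrite jN; have [] := run_nth R jN.
pose rho : pairing F := [ffun j : 'I_N.+1 =>
  [ffun i : 'I_(width F j) => insubd i (mate (nth g fs j) i)]].
have rhoE (j : 'I_N.+1) (i : 'I_(width F j)) : rho j i = mate (nth g fs j) i :> nat.
  rewrite !ffunE insubdK //; have jN : j <= N by rewrite -ltnS.
  have [|h _ _] := ms _ jN i; first by rewrite sz.
  by move: h; rewrite sz.
have prho j i : j <= N -> partner rho j i = mate (nth g fs j) i.
  move=> jN; case: (ltnP i (width F j)) => Hi.
    by rewrite -[RHS](rhoE (Ordinal (jN : j < N.+1)) (Ordinal Hi)) -partner_ord.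
  by rewrite partner_out // mate_out // sz.
exists rho; split=> //.
  apply/andP; split; [apply/and3P; split|].
  - apply/forallP => j; apply/forallP => i; have jN : j <= N by rewrite -ltnS.
    have [|h1 h2 h3] := ms _ jN i; first by rewrite sz.
    by rewrite -!val_eqE /= !rhoE h3 h2 /=.
  - apply/forallP => i; rewrite !prho // fN nth0 hg //.
  - apply/forallP => j; have [_ []] := run_nth R (ltn_ord j).
    rewrite !sz // ?(ltnW (ltn_ord j)) // => _ _ _ _.
    rewrite -(@eq_ruled_event _ _ _ (partner rho j) _ (partner rho j.+1)) // => i.
      by rewrite prho // ltnW.
    by rewrite prho.
  apply/forallP => j; apply/forallP => i; apply/implyP.
  have jN : j <= N by rewrite -ltnS.
  rewrite prho // !muE => lt; have [_ H] := gs _ jN.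
  by apply: H => //; rewrite sz.
rewrite switches_ruling_mates (run_switches R); apply: eq_big_nat => j /andP[_ jN].
suff E i : i <= N -> ruling_mates rho i = nth g fs i by rewrite !E // ltnW.
move=> iN; apply: (@eq_from_nth _ 0); rewrite size_mkseq ?sz // => k kw.
rewrite nth_mkseq // prho // /mate.
by apply: set_nth_default; rewrite sz.
Qed.

End Rulings.

(** * The n-copy of a front *)

Definition linked d rs w f g c : Prop :=
  exists2 fs, head g fs = f & run d rs fs w g c.

Lemma linked_nil d f : linked d [::] [::] f f 0.
Proof. by exists [::] => //; apply: run_nil. Qed.

Lemma head_cat (T : Type) (g : T) s1 s2 : head g (s1 ++ s2) = head (head g s2) s1.
Proof. by case: s1. Qed.

Lemma linked_cat d rs1 rs2 w1 w2 f g h c1 c2 :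
  linked d rs1 w1 f g c1 -> linked d rs2 w2 g h c2 ->
  linked d (rs1 ++ rs2) (w1 ++ w2) f h (c1 + c2).
Proof.
move=> [fs1 h1 R1] [fs2 h2 R2]; exists (fs1 ++ fs2); first by rewrite head_cat h2.
by apply: run_cat R2; rewrite h2.
Qed.

Lemma linked_mirror d r0 rs w f g c :
  linked d (belast r0 rs) w f g c -> graded_row d (last r0 rs) g ->
  linked d (rev rs) (mirror w) g f c.
Proof.
move=> [fs hd R] gl; have := run_mirror R gl; rewrite hd => R'.
exists (rev (behead (rcons fs g))) => //.
by case: fs hd {R R'} => [|a s] //= _; rewrite rev_rcons.
Qed.

Lemma mirror_eventK : involutive mirror_event.
Proof. by case. Qed.

Lemma mirrorK : involutive mirror.
Proof. by move=> w; rewrite /mirror map_rev revK mapK //; apply: mirror_eventK. Qed.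

Definition is_lcusp (e : event) : bool := if e is LCusp _ then true else false.
Definition is_rcusp (e : event) : bool := if e is RCusp _ then true else false.

Lemma right_cusps_word F : right_cusps F = count is_rcusp (word F).
Proof.
rewrite /right_cusps /cusps.
have -> l : count (fun c : nat * nat * bool => c.2) (pmap (cusp_at F) l) =
    count is_rcusp [seq ev F j | j <- l].
  by elim: l => //= j l IH; rewrite /cusp_at; case: (ev F j) => k /=; rewrite IH.
by congr count; apply: (mkseq_nth (Crossing 0) (word F)).
Qed.

(** The number of strands returns to its initial value. *)
Lemma cusps_balanced F : is_front F ->
  count is_lcusp (word F) = count is_rcusp (word F).
Proof.
move=> [ft wN].
have H j : j <= size (word F) -> width F j + 2 * count is_rcusp (take j (word F)) =
    base F + 2 * count is_lcusp (take j (word F)).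
  elim: j => [|j IH] jN; first by rewrite width0 take0.
  rewrite widthS // (take_nth (Crossing 0) jN) -cats1 !count_cat /=.
  move: (IH (ltnW jN)) (ft j jN); rewrite -/(ev F j).
  by move: (count is_rcusp _) (count is_lcusp _) (ev F j) => a b [] k /=; lia.
have := H _ (leqnn _); rewrite take_size wN; lia.
Qed.

Lemma count_crossings (a : pred event) (h : nat -> nat -> nat) s (r : nat -> seq nat) :
  (forall k, ~~ a (Crossing k)) ->
  count a [seq Crossing (h t u) | t <- s, u <- r t] = 0.
Proof.
move=> ha; elim: s => //= t s IH; rewrite count_cat IH addn0 count_map.
by rewrite (eq_count (a2 := pred0)) ?count_pred0 // => u; apply/negbTE/ha.
Qed.

Lemma count_rcusp_copy n e : count is_rcusp (copy n e) = n * is_rcusp e.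
Proof.
case: e => k /=; rewrite ?muln0 ?muln1 ?count_crossings //.
- rewrite /copy_lcusp count_cat count_crossings // addn0.
  by rewrite count_map; elim: iota.
- rewrite /mirror count_rev count_map (eq_count (a2 := is_lcusp)); last by case.
  rewrite /copy_lcusp count_cat count_crossings // addn0.
  by rewrite count_map -[RHS](size_iota 0) -count_predT; apply: eq_count.
Qed.

Lemma count_rcusp_copies n w :
  count is_rcusp (flatten (map (copy n) w)) = n * count is_rcusp w.
Proof.
elim: w => [|e w IH] /=; first by rewrite muln0.
by rewrite count_cat IH count_rcusp_copy mulnDr.
Qed.

Lemma copy_crossing_shift n k :
  copy n (Crossing k) = map (shift_event (n * k)) (copy n (Crossing 0)).
Proof.
rewrite /= muln0 map_flatten -map_comp; congr flatten; apply: eq_map => t /=.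
by rewrite -map_comp.
Qed.

Lemma mirror_shift a w : mirror (map (shift_event a) w) = map (shift_event a) (mirror w).
Proof.
rewrite /mirror map_rev -!map_comp; congr rev.
by apply: eq_map => -[].
Qed.

Lemma copy_rcusp_shift n k :
  copy n (RCusp k) = map (shift_event (n * k)) (copy n (RCusp 0)).
Proof.
rewrite /= -mirror_shift; congr mirror; rewrite /copy_lcusp muln0 map_cat -map_comp.
congr (_ ++ _); rewrite map_flatten -map_comp; congr flatten; apply: eq_map => t /=.
by rewrite -map_comp.
Qed.

(** Each pair has exactly one member whose partner is above it. *)
Lemma half_matching f : matching f ->
  2 * count (fun i => mate f i < i) (iota 0 (size f)) = size f.
Proof.
move=> mf; set n := size f; pose a i := mate f i < i; pose b i := i < mate f i.
have P : perm_eq (map (mate f) (iota 0 n)) (iota 0 n).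
  apply: uniq_perm; rewrite ?iota_uniq //.
    rewrite map_inj_in_uniq ?iota_uniq // => i j; rewrite !mem_iota /= !add0n => Hi Hj E.
    by have [_ _ <-] := mf i Hi; have [_ _ <-] := mf j Hj; rewrite E.
  move=> i; rewrite mem_iota add0n /=; apply/mapP/idP => [[j]|Hi].
    by rewrite mem_iota add0n /= => Hj ->; have [] := mf j Hj.
  by have [h _ E] := mf i Hi; exists (mate f i); rewrite ?E // mem_iota add0n.
have ab : count a (iota 0 n) = count b (iota 0 n).
  rewrite -(permP P a) count_map; apply: eq_in_count => i; rewrite mem_iota add0n /= => Hi.
  by rewrite /a /b; have [_ _ ->] := mf i Hi.
rewrite mul2n -addnn -/a {2}ab -count_predUI.
rewrite (eq_count (a1 := predI a b) (a2 := pred0)) => [|i]; last first.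
  by rewrite /= /a /b; case: ltngtP.
rewrite count_pred0 addn0 (eq_in_count (a2 := predT)) ?count_predT ?size_iota // => i.
rewrite mem_iota add0n /= => Hi; have [_ h _] := mf i Hi.
by rewrite /a /b; case: ltngtP h.
Qed.

Section Copies.

Variables (d : nat) (K L : front) (mu eta : nat -> nat -> int) (f0 : seq nat).
Hypotheses (fK : is_front K)
  (cK : forall j k b, (j, k, b) \in cusps K -> (mu j k = mu j k.+1 + 1 %[mod d])%Z).

Local Notation n := (base L).
Local Notation e := [seq eta 0 i | i <- iota 0 n].

Hypotheses (mf : matching f0) (sf : size f0 = n) (ge : graded_row d e f0).

Local Notation half := (count (fun i => mate f0 i < i) (iota 0 n)).

(** Potentials of the copies of consecutive strands of potentials [s]. *)
Definition copies_values (s : seq int) : seq int := [seq (x + t)%R | x <- s, t <- e].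

Lemma copies_values_cat s1 s2 : copies_values (s1 ++ s2) = copies_values s1 ++ copies_values s2.
Proof. by rewrite /copies_values map_cat flatten_cat. Qed.

Lemma copies_rowE j : copies_row K L mu eta j = copies_values [seq mu j a | a <- iota 0 (width K j)].
Proof. by rewrite /copies_values allpairs_mapl allpairs_mapr. Qed.

Lemma graded_copies_values s : graded_row d (copies_values s) (copies (size s) f0).
Proof.
elim: s => [|x s IH]; first by split.
rewrite -cat1s copies_values_cat /=; apply: graded_dsum => //; last exact: matching_copies.
by rewrite /copies_values /= cats0; apply: graded_shift.
Qed.

Lemma size_copies_values s : size (copies_values s) = n * size s.
Proof. by rewrite size_allpairs size_map size_iota mulnC. Qed.

Lemma sweep_between s1 x y s2 w r b c :
  sweep d (pair_rows e x y) (dsum f0 f0) w r (copies b f0) c ->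
  exists r', sweep d (copies_values (s1 ++ x :: y :: s2)) (copies (size s1 + 2 + size s2) f0)
    (map (shift_event (n * size s1)) w) r' (copies (size s1 + b + size s2) f0) c.
Proof.
move=> S; exists (copies_values s1 ++ r ++ copies_values s2).
have := @sweep_dsum d (copies_values s1) (copies (size s1) f0) (copies_values s2) (copies (size s2) f0)
  (pair_rows e x y) (dsum f0 f0) w r (copies b f0) c.
rewrite -(_ : copies_values (s1 ++ x :: y :: s2) = copies_values s1 ++ pair_rows e x y ++ copies_values s2); last first.
  by rewrite copies_values_cat /copies_values /= -!catA.
have E2 : copies 2 f0 = dsum f0 f0 by rewrite (copiesD 1 1) copies1.
rewrite size_copies sf -!addnA !(copiesD (size s1)) (copiesD 2) (copiesD b) E2.
apply=> //; try exact: graded_copies_values; try exact: matching_copies.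
exact: matching_dsum.
Qed.

Lemma sweep_linked r f w r' g c : sweep d r f w r' g c ->
  linked d (belast r (scanl (@carry int) r w)) w f g c /\
  graded_row d (last r (scanl (@carry int) r w)) g.
Proof.
move=> S; have := sweep_graded_last S.
have [<- H] := sweep_run S; split=> //.
Qed.

Lemma width_split j k : k.+1 < width K j ->
  [seq mu j a | a <- iota 0 (width K j)] =
  [seq mu j a | a <- iota 0 k] ++ mu j k :: mu j k.+1 ::
  [seq mu j a | a <- iota k.+2 (width K j - k.+2)].
Proof.
move=> kw; rewrite -{1}(subnKC kw) -[X in iota 0 (X + _)]addn2 -addnA iotaD map_cat.
by [].
Qed.

(** For a left cusp the piece is the mirror image of that of a right cusp,
    read from the region on its right, as in the definition of [copy_rows]. *)
Lemma linked_copy j : j < size (word K) ->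
  linked d (copy_rows K L mu eta j) (copy n (ev K j))
    (copies (width K j) f0) (copies (width K j.+1) f0)
    (half * (is_lcusp (ev K j) || is_rcusp (ev K j))).
Proof.
move=> jN; have [ft _] := fK; have ftj := ft j jN; have wS := widthS jN.
have cj c : cusp_at K j = Some c -> c \in cusps K.
  by move=> E; rewrite mem_pmap; apply/mapP; exists j; rewrite ?mem_iota ?E.
rewrite /copy_rows; rewrite /cusp_at in cj.
case: (ev K j) ftj wS cj => k /= ftj wS cj; rewrite -/(copy n _).
- rewrite muln0 wS -[flatten _]/(copy n (Crossing k)).
  have [r S] := sweep_crossing (mu j k) (mu j k.+1) mf ge; rewrite sf in S.
  have : dsum f0 f0 = copies 2 f0 by rewrite (copiesD 1 1) copies1.
  move=> E; rewrite {2}E in S.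
  have [r' S'] := sweep_between [seq mu j a | a <- iota 0 k]
     [seq mu j a | a <- iota k.+2 (width K j - k.+2)] S.
  have [+ _] := sweep_linked S'.
  rewrite -width_split // -copies_rowE !size_map !size_iota -copy_crossing_shift.
  by rewrite addn2 subnKC.
- rewrite muln1 -[mirror _]/(copy n (RCusp k)).
  have kw : k.+1 < width K j.+1 by rewrite wS !ltnS.
  have xy : (mu j.+1 k == mu j.+1 k.+1 + 1 %[mod d])%Z.
    by apply/eqP; apply: cK; apply: cj.
  have S := sweep_rcusp mf ge xy; rewrite sf in S.
  have [r' S'] := sweep_between (b := 0) [seq mu j.+1 a | a <- iota 0 k]
     [seq mu j.+1 a | a <- iota k.+2 (width K j.+1 - k.+2)] S.
  rewrite -width_split // -copies_rowE !size_map !size_iota -copy_rcusp_shift in S'.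
  have [R gl] := sweep_linked S'.
  have := linked_mirror R gl.
  have -> : mirror (copy n (RCusp k)) = copy_lcusp n k by apply: mirrorK.
  rewrite addn2 subnKC // addn0.
  by rewrite (_ : k + (width K j.+1 - k.+2) = width K j) // wS !subSS subnKC.
- rewrite muln1 -[mirror _]/(copy n (RCusp k)).
  have xy : (mu j k == mu j k.+1 + 1 %[mod d])%Z.
    by apply/eqP; apply: cK; apply: cj.
  have S := sweep_rcusp mf ge xy; rewrite sf in S.
  have [r' S'] := sweep_between (b := 0) [seq mu j a | a <- iota 0 k]
     [seq mu j a | a <- iota k.+2 (width K j - k.+2)] S.
  rewrite -width_split // -copies_rowE !size_map !size_iota -copy_rcusp_shift in S'.
  have [+ _] := sweep_linked S'.
  rewrite addn2 subnKC // addn0 wS.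
  by rewrite (_ : k + (width K j - k.+2) = width K j - 2) //; lia.
Qed.

Lemma linked_copies i m : i + m <= size (word K) ->
  linked d (flatten (map (copy_rows K L mu eta) (iota i m)))
    (flatten (map (copy n) (take m (drop i (word K)))))
    (copies (width K i) f0) (copies (width K (i + m)) f0)
    (half * count (predU is_lcusp is_rcusp) (take m (drop i (word K)))).
Proof.
elim: m i => [|m IH] i im; first by rewrite take0 muln0 addn0; apply: linked_nil.
have iN : i < size (word K) by apply: leq_trans im; rewrite addnS ltnS leq_addr.
rewrite (drop_nth (Crossing 0) iN) /= mulnDr; apply: linked_cat.
  exact: linked_copy.
by rewrite -addSnnS; apply: IH; rewrite addSnnS.
Qed.

End Copies.

(** * The inserted front *)

Lemma nth_cat_head (T : Type) (g : T) s1 s2 q : q <= size s1 ->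
  nth g (s1 ++ s2) q = nth (head g s2) s1 q.
Proof.
rewrite nth_cat leq_eqVlt => /orP[/eqP ->|H].
  by rewrite ltnn subnn nth0 nth_default.
by rewrite H; apply: set_nth_default.
Qed.

Lemma iota_rcons k m : iota k m.+1 = rcons (iota k m) (k + m).
Proof. by rewrite -[in LHS]addn1 iotaD cats1. Qed.

Lemma belast_iota k m : belast k (iota k.+1 m) = iota k m.
Proof. by elim: m k => //= m IH k; rewrite IH. Qed.

Section Insertion.

Variables (d : nat) (K L : front) (oK : nat -> nat -> bool).
Variables (mu eta : nat -> nat -> int) (p s : nat) (rho : pairing L).
Hypotheses (fL : is_front L) (nr : normal_ruling rho) (gr : graded d eta rho).
Hypothesis sp : s < width K p.

Local Notation n := (base L).
Local Notation N := (size (word L)).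
Local Notation f0 := (ruling_mates rho 0).

Lemma size_f0 : size f0 = n.
Proof. by rewrite size_mkseq width0. Qed.

Lemma matching_f0 : matching f0.
Proof. exact: matching_ruling_mates. Qed.

Lemma matching_f0_copies m : matching (copies m f0).
Proof. by apply: matching_copies; apply: matching_f0. Qed.

Lemma graded_f0 : graded_row d [seq eta 0 i | i <- iota 0 n] f0.
Proof. by rewrite -width0; apply: graded_ruling_mates. Qed.

Local Notation A := (copies s f0).
Local Notation B := (copies (width K p - s.+1) f0).

(** The pairing at stage [q] of the inserted front: [s] strands of [K] pass
    above it, the remaining ones below. *)
Definition inserted q : seq nat := dsum A (dsum (ruling_mates rho q) B).

Local Notation copies_values := (copies_values L eta).

Definition inserted_row q : seq int :=
  copies_values [seq mu p a | a <- iota 0 s] ++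
  [seq (mu p s + eta q b)%R | b <- iota 0 (width L q)] ++
  copies_values [seq mu p a | a <- iota s.+1 (width K p - s.+1)].

Lemma inserted0 : inserted 0 = copies (width K p) f0.
Proof.
rewrite -[in RHS](subnKC sp) -addn1 -addnA !copiesD copies1.
by rewrite addn1.
Qed.

(** The ruling of a closed front is the same at both ends; this is what makes
    the insertion fit with the copies of [K] around it, in either direction. *)
Lemma insertedN : inserted N = inserted 0.
Proof. by rewrite /inserted ruling_mates_last. Qed.

Lemma size_above : size A = n * s.
Proof. by rewrite size_copies size_f0. Qed.

Lemma mate_inserted q b : q <= N -> b < width L q ->
  mate (inserted q) (n * s + b) = n * s + partner rho q b.
Proof.
move=> qN bw; rewrite !mate_dsum size_above ifN -?leqNgt ?leq_addr // addKn.
by rewrite size_mkseq bw mate_ruling_mates.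
Qed.

Lemma graded_inserted q : q <= N -> graded_row d (inserted_row q) (inserted q).
Proof.
move=> qN; have mB := matching_f0_copies.
have mq := matching_ruling_mates nr qN.
have gB m k : graded_row d (copies_values [seq mu p a | a <- iota k m]) (copies m f0).
  have := graded_copies_values matching_f0 graded_f0 [seq mu p a | a <- iota k m].
  by rewrite size_map size_iota.
apply: graded_dsum => //; last exact: matching_dsum.
apply: graded_dsum => //.
have := graded_shift mq (graded_ruling_mates nr gr qN) (mu p s).
by rewrite -map_comp.
Qed.

Lemma insertion_rowsE :
  insertion_rows K L oK p s mu eta =
  [seq inserted_row q | q <- if oK p s then iota 0 N else rev (iota 1 N)].
Proof.
have rE : copies_row K L mu eta p =
    copies_values [seq mu p a | a <- iota 0 s] ++ copies_values [:: mu p s] ++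
    copies_values [seq mu p a | a <- iota s.+1 (width K p - s.+1)].
  rewrite copies_rowE -!copies_values_cat -{1}(subnKC sp) -[X in iota 0 (X + _)]addn1.
  by rewrite -addnA iotaD map_cat.
apply: eq_map => q; rewrite /inserted_row rE take_size_cat; last first.
  by rewrite size_copies_values size_map size_iota.
by rewrite catA drop_size_cat // size_cat !size_copies_values size_map size_iota -mulnDr addn1.
Qed.

Lemma step_inserted j : j < N ->
  step (shift_event (n * s) (ev L j)) (inserted j) (inserted j.+1).
Proof.
move=> jN; have mB := matching_f0_copies.
rewrite -size_above; apply: step_dsum_l => //; apply: step_dsum_r => //.
exact: step_ruling_mates.
Qed.

Lemma switch_inserted j : j < N ->
  switch_at (shift_event (n * s) (ev L j)) (inserted j) (inserted j.+1) =
  switch_at (ev L j) (ruling_mates rho j) (ruling_mates rho j.+1).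
Proof.
move=> jN; rewrite -size_above switch_dsum_l; apply: switch_dsum_r.
exact: step_ruling_mates.
Qed.

Lemma run_inserted j m : j + m = N ->
  run d (map inserted_row (iota j m)) (map inserted (iota j m))
    (map (shift_event (n * s)) (drop j (word L))) (inserted N)
    (\sum_(j <= i < N)
       switch_at (ev L i) (ruling_mates rho i) (ruling_mates rho i.+1)).
Proof.
elim: m j => [|m IH] j jm.
  by rewrite -jm addn0 drop_oversize ?big_geq -?jm ?addn0 //=; apply: run_nil.
have jN : j < N by rewrite -jm addnS ltnS leq_addr.
have hd : head (inserted N) (map inserted (iota j.+1 m)) = inserted j.+1.
  by case: m {IH} jm => //; rewrite addn1 => ->.
rewrite (drop_nth (Crossing 0) jN) big_ltn //= -switch_inserted // -hd.
apply: run_cons; rewrite ?hd.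
- exact/graded_inserted/ltnW.
- exact: step_inserted.
- by apply: IH; rewrite addSnnS.
Qed.

(** Over a strand oriented to the left the pattern is reflected, so its stages
    are met in the opposite order. *)
Lemma run_insertion : exists fs,
  [/\ head (inserted 0) fs = inserted 0,
      run d (insertion_rows K L oK p s mu eta) fs
        (map (shift_event (n * s)) (insertion L (oK p s))) (inserted 0) (switches rho)
    & forall q, q <= N ->
        nth (inserted 0) fs (if oK p s then q else N - q) = inserted q].
Proof.
rewrite insertion_rowsE /insertion switches_ruling_mates.
have := run_inserted (add0n N); rewrite drop0 insertedN => R.
have hd : head (inserted 0) (map inserted (iota 0 N)) = inserted 0 by case: N.
case: ifP => _.
  exists (map inserted (iota 0 N)); split=> // q.
  rewrite leq_eqVlt => /orP[/eqP ->|qN].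
    by rewrite nth_default ?size_map ?size_iota // insertedN.
  by rewrite (nth_map 0) ?size_iota // nth_iota.
exists (rev (map inserted (iota 1 N))); split.
- rewrite -{2}insertedN; case: N => // k.
  by rewrite iota_rcons map_rcons rev_rcons add1n.
- have := @run_mirror d (inserted_row 0) (map inserted_row (iota 1 N))
    (map inserted (iota 0 N)) (map (shift_event (n * s)) (word L)) (inserted 0).
  rewrite belast_map belast_iota hd last_map -map_rev -mirror_shift.
  have -> : behead (rcons (map inserted (iota 0 N)) (inserted 0)) =
      map inserted (iota 1 N).
    by rewrite -insertedN -map_rcons -iota_rcons.
  apply; first exact: R.
  have -> : last 0 (iota 1 N) = N by case: N => // k; rewrite iota_rcons last_rcons add1n.
  by rewrite -insertedN; apply: graded_inserted.
move=> q; rewrite leq_eqVlt => /orP[/eqP ->|qN].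
  rewrite subnn; case: N => [|k] //.
  by rewrite iota_rcons map_rcons rev_rcons add1n.
case: (posnP q) => [->|q0].
  by rewrite subn0 nth_default // size_rev size_map size_iota.
rewrite nth_rev ?size_map ?size_iota; last by rewrite ltn_subrL q0 (leq_ltn_trans _ qN).
rewrite (nth_map 0) ?size_iota ?nth_iota; try by rewrite subnSK // ?leq_subr //; lia.
by congr inserted; lia.
Qed.

End Insertion.

(** * Counting rulings *)

Lemma coeff_ruling_polynomial m d F mu :
  coeff m (ruling_polynomial d F mu) =
  (#|[set rho : pairing F | [&& normal_ruling rho, graded d mu rho
                             & ruling_degree rho == m]]|%:R)%R.
Proof.
rewrite /ruling_polynomial raddf_sum /= -sum1_card natr_sum big_mkcond [RHS]big_mkcond.
apply: eq_bigr => rho _; rewrite inE coeffU mul1r andbA eq_sym.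
by case: (_ && _); case: (_ == _).
Qed.

(** Counting by a relation avoids naming an injection: the ruling of the
    satellite is only known to exist. *)
Lemma leq_card_rel (T U : finType) (P : {set T}) (Q : {set U}) (R : T -> U -> Prop) :
  (forall x, x \in P -> exists2 y, y \in Q & R x y) ->
  (forall x x' y, x \in P -> x' \in P -> R x y -> R x' y -> x = x') ->
  #|P| <= #|Q|.
Proof.
move=> ex inj; case: (pickP (mem P)) => [x0 x0P|P0]; last by rewrite (eq_card0 P0).
have [y0 _ _] := ex x0 x0P.
have [g gP] : exists g : T -> U, forall x, x \in P -> g x \in Q /\ R x (g x).
  apply: (@fin_all_exists _ (fun=> U) (fun x y => x \in P -> y \in Q /\ R x y)) => x.
  case xP: (x \in P); last by exists y0.
  by have [y yQ Ry] := ex x xP; exists y.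
rewrite -(card_in_imset (f := g)) => [|x x' xP x'P E].
  by apply/subset_leq_card/subsetP => _ /imsetP[x xP ->]; have [] := gP x xP.
have [_ Rx] := gP x xP; have [_ Rx'] := gP x' x'P.
by apply: inj Rx _ => //; rewrite E.
Qed.

Lemma count_take_drop (T : Type) (a : pred T) p s :
  count a (take p s) + count a (drop p s) = count a s.
Proof. by rewrite -count_cat cat_take_drop. Qed.

(** Existence of the extension.  The second part says that the ruling of [L]
    can be read off on the inserted front, whose stages lie after the copies of
    the singularities of [K] to the left of the base point. *)
Lemma satellite_ruling (d : nat) (K L : front) (oK : nat -> nat -> bool)
    (mu eta : nat -> nat -> int) (p s : nat) (rho : pairing L) :
  is_front K -> base K = 0 ->
  (forall j k b, (j, k, b) \in cusps K -> (mu j k = mu j k.+1 + 1 %[mod d])%Z) ->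
  is_front L -> normal_ruling rho -> graded d eta rho ->
  p <= size (word K) -> s < width K p ->
  let S := satellite K L oK p s in
  exists2 rho' : pairing S,
    [/\ normal_ruling rho',
      graded d (satellite_potential K L oK p s mu eta) rho'
      & ruling_degree rho' = ruling_degree rho]
    & forall q b, q <= size (word L) -> b < width L q ->
        partner rho' (size (flatten (map (copy (base L)) (take p (word K))))
                      + if oK p s then q else size (word L) - q)
                     (base L * s + b)
        = base L * s + partner rho q b.
Proof.
move=> fK K0 cK fL nr gr pK sp S.
set n := base L; set o := oK p s; set w := word K.
have sf := size_f0 rho; have mf := matching_f0 nr.
have ge := graded_f0 nr gr; set f0 := ruling_mates rho 0 in sf mf ge.
set h := count (fun i => mate f0 i < i) (iota 0 n).
have hn : 2 * h = n by rewrite /h /n -sf half_matching.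
have [|fs1 hd1 R1] := linked_copies fK cK mf sf ge (i := 0) (m := p).
  by rewrite add0n.
have [|fs2 hd2 R2] := linked_copies fK cK mf sf ge (i := p) (m := size w - p).
  by rewrite subnKC.
rewrite subnKC // in hd2 R2.
have [_ wN] := fK; have wN0 : width K (size w) = 0 by rewrite wN K0.
rewrite wN0 /= in hd2 R2.
rewrite take_oversize ?size_drop // in R2.
rewrite drop0 add0n in R1; rewrite add0n in hd1.
have [fsI [hdI RI nthI]] := run_insertion oK mu fL nr gr sp.
rewrite inserted0 // -/f0 in hdI RI nthI.
rewrite -hd2 in RI; rewrite -hdI in R1.
have RI2 := run_cat RI R2.
rewrite -hd2 -head_cat in R1; have R := run_cat R1 RI2.
have [srs1 sfs1] := run_size R1; have [_ sfsI] := run_size RI.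
have wE : word S = flatten (map (copy n) (take p w)) ++
    map (shift_event (n * s)) (insertion L o) ++
    flatten (map (copy n) (drop p w)) by [].
rewrite -wE in R.
have [] := @ruling_of_run S d (satellite_potential K L oK p s mu eta)
  _ _ [::] (copies_row K L mu eta (size w)) _ R.
- by rewrite !head_cat hd2 hdI hd1 width0 K0.
- by [].
- by [].
- by rewrite /copies_row wN0.
- by move=> j i; rewrite /satellite_potential /satellite_rows !rcons_cat -!cats1.
move=> rho' [/andP[nr' gr'] sw prt].
exists rho'; first split=> //.
  rewrite /ruling_degree sw !right_cusps_word wE !count_cat !count_rcusp_copies.
  have -> : count is_rcusp (map (shift_event (n * s)) (insertion L o)) =
      count is_rcusp (word L).
    rewrite count_map /insertion; case: ifP => _; first by apply: eq_count => -[].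
    rewrite -(cusps_balanced fL) /mirror count_rev count_map.
    by apply: eq_count => -[].
  have cc v : count (predU is_lcusp is_rcusp) v = count is_lcusp v + count is_rcusp v.
    elim: v => //= e v ->; case: e => k /=; lia.
  (* Each cusp of K brings half of n switches, each right cusp of K brings n
     right cusps, and half of the cusps of K are right cusps. *)
  have key : h * count (predU is_lcusp is_rcusp) (take p w)
      + h * count (predU is_lcusp is_rcusp) (drop p w) =
      n * count is_rcusp (take p w) + n * count is_rcusp (drop p w).
    rewrite -!mulnDr !count_take_drop cc (cusps_balanced fK) addnn -mul2n mulnA.
    by rewrite (mulnC h) hn.
  move: key; rewrite -/w -/n -/h.
  move: (count is_rcusp (word L)) (switches _).
  move: (h * _) (h * _) (n * _) (n * _).
  by clear; lia.
move=> q b qL bw; rewrite prt; last first.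
  rewrite wE !size_cat leq_add2l.
  rewrite (leq_trans _ (leq_addr _ _)) // size_map /insertion.
  by case: (o); rewrite ?size_rev ?size_map ?leq_subr.
rewrite -sfs1 nth_cat ltnNge leq_addr /= addKn nth_cat_head.
  by rewrite hd2 nthI // mate_inserted.
by rewrite sfsI size_map /insertion -/o; case: (o); rewrite ?size_rev ?size_map ?leq_subr.
Qed.

Theorem corollary3p5 (d : nat) (K L : front) (oK oL : nat -> nat -> bool)
    (mu eta : nat -> nat -> int) (p s : nat)
    (K_front : is_front K) (K_in_R3 : base K = 0) (K_knot : is_connected K)
    (oK_orient : is_orientation K oK) (dK : d %| 2 * rotation K oK)
    (mu_maslov : maslov_potential d K oK mu)
    (L_front : is_front L)
    (oL_orient : is_orientation L oL) (dL : d %| 2 * rotation L oL)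
    (eta_maslov : maslov_potential d L oL eta)
    (p_region : p <= size (word K)) (s_strand : s < width K p)
    (m : int) :
  (coeff m (ruling_polynomial d L eta) <=
   coeff m (ruling_polynomial d (satellite K L oK p s)
              (satellite_potential K L oK p s mu eta)))%R.
Proof.
have [_ cK _] := mu_maslov.
rewrite !coeff_ruling_polynomial ler_nat.
pose S := satellite K L oK p s.
apply: (@leq_card_rel _ _ _ _ (fun (rho : pairing L) (rho' : pairing S) =>
  forall q b, q <= size (word L) -> b < width L q ->
    partner rho' (size (flatten (map (copy (base L)) (take p (word K))))
                  + if oK p s then q else size (word L) - q)
                 (base L * s + b)
    = base L * s + partner rho q b)).
- move=> rho; rewrite inE => /and3P[nr gr /eqP <-].
  have [rho' [nr' gr' dg] ext] :=
    satellite_ruling oK K_front K_in_R3 cK L_front nr gr p_region s_strand.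
  by exists rho' => //; rewrite inE nr' gr' dg eqxx.
move=> rho1 rho2 rho' _ _ H1 H2; apply/ffunP => j; apply/ffunP => i.
apply/val_inj; rewrite /= -!partner_ord.
have jN : j <= size (word L) by rewrite -ltnS.
by apply/(@addnI (base L * s)); rewrite -H1 // -H2.
Qed.
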